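(* Let $n\ge1$ and let $X$ be an odd nilpotent element of $\mathfrak{osp}(2n+1,2n)$, with associated marked diagram $D(X)$. For each admissible slicing $\underline{D}\in\mathcal{A}(D(X))$, the subset $B_X(\underline{D})$ is locally closed in the Springer fiber $B_X$, and $$B_X=\coprod_{\underline{D}\in\mathcal{A}(D(X))}B_X(\underline{D}).$$
   Context: We work over $\mathbb{C}$. Setting. For $m,r\ge 0$ let $V=V_0\oplus V_1$ be a $\mathbb{Z}/2\mathbb{Z}$-graded vector space with $\dim V_0=m$, $\dim V_1=2r$, equipped with a bilinear form $B$ for which $V_0\perp V_1$ and whose restrictions $\varphi:V_0\to V_0^\vee$, $\psi:V_1\to V_1^\vee$ are non-degenerate, respectively symmetric and alternating. For $u\in\mathrm{Hom}(V_0,V_1)$ let $u^*=\varphi^{-1}\circ u^t\circ\psi$. The odd elements of $\mathfrak{osp}(m,2r)$ are the endomorphisms $X=(u,u^* )$ of $V$ (acting as $u$ on $V_0$ and $u^*$ on $V_1$). Springer fiber. Let $m=2n+1$, $r=n$. For $X=(u,u^* )$ odd nilpotent, $B_X$ is the variety of pairs $((E_i)_{1\le i\le n},(F_j)_{1\le j\le n})$ of complete isotropic flags in $V_0$ and $V_1$ respectively ($\dim E_i=i$, $\dim F_j=j$, $E_0=F_0=0$) such that $u(E_i)\subset F_{i-1}$ and $u^*(F_i)\subset E_i$ for all $i$. Diagrams. A marked diagram of size $(m,r')$ is a Young diagram with $m$ boxes labelled $0$ and $r'$ boxes labelled $1$, labels alternating along each line (row); a diagram is determined by the multiset of its lines.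 A line beginning with $\epsilon$ has parity $\epsilon$ (even if $\epsilon=0$, odd if $\epsilon=1$). A diagram is indecomposable if it is one of: an even line of length $4p+1$; an odd line of length $4p-1$; two even lines of length $4p-1$; two odd lines of length $4p+1$; two lines of length $2p$, one even and one odd. It is admissible if it is a union of indecomposable diagrams. To an odd nilpotent $X$ is associated the admissible diagram $D(X)$ in which, for all $k\ge1$ and $\epsilon\in\{0,1\}$, the number of lines of parity $\epsilon$ and length at least $k$ equals $\dim(\ker X\cap\mathrm{Im}\,X^{k-1}\cap V_\epsilon)$. Slicings. An admissible diagram has parity $\epsilon\in\{0,1\}$ if its size is $(2l+(-1)^\epsilon,2l)$ for some $l$. If $D$ is an admissible diagram having a parity, an admissible subdiagram of $D$ is a subdiagram $D'$ such that: $D'$ is admissible; $D'$ has two boxes less than $D$; $D'$ and $D$ have different parities; the two boxes of $D\setminus D'$ are at the beginning and at the end of lines of the same length (one box is the first box of a line of $D$ and the other is the last box of a line of $D$ of the same length, possibly the same line). For $D$ admissible of size $(2n+1,2n)$, an admissible slicing of $D$ is a sequence $\underline{D}=(D_i)_{0\le i\le 2n}$ with $D_0=D$ and $D_i$ an admissible subdiagram of $D_{i-1}$ for $1\le i\le 2n$. The set of these is $\mathcal{A}(D)$. Subsets. For $((E_i),(F_j))\in B_X$ and $1\le i\le n$, let $X_{2i-1}$ (resp. $X_{2i}$) be the endomorphism induced by $X$ on $(E_i\oplus F_{i-1})^\perp/(E_i\oplus F_{i-1})$ (resp. on $(E_i\oplus F_i)^\perp/(E_i\oplus F_i)$); it is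 an odd orthosymplectic nilpotent endomorphism. For $\underline{D}=(D_i)\in\mathcal{A}(D(X))$, $$B_X(\underline{D})=\{((E_i),(F_j))\in B_X : D(X_{2i-1})=D_{2i-1}\text{ and }D(X_{2i})=D_{2i}\text{ for all }1\le i\le n\}.$$ *)

(* Defs.v *)
From HB Require Import structures.
From mathcomp Require Import all_boot all_order all_algebra.
From mathcomp Require Import finmap multiset mpoly complex.
From mathcomp Require Import boolp classical_sets reals.

Set Implicit Arguments.
Unset Strict Implicit.
Unset Printing Implicit Defensive.

Import GRing.Theory.
Local Open Scope ring_scope.

(* [(e, l)] is a line with l boxes whose first box is labelled e, where
   [false] stands for 0 and [true] for 1; labels alternate along the line. *)
Notation line := (bool * nat)%type.

Definition line_boxes (d : bool) (x : line) : nat :=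
  if x.1 == d then uphalf x.2 else x.2./2.

(* [(e, 0)] is not a line: an admissible diagram never contains it. *)
Notation diagram := {mset line}%mset.

Definition boxes (d : bool) (D : diagram) : nat :=
  (\sum_(x <- D) line_boxes d x)%N.

Definition diagram_size (D : diagram) : nat * nat :=
  (boxes false D, boxes true D).

Definition lines_ge (D : diagram) (e : bool) (k : nat) : nat :=
  count (fun x : line => (x.1 == e) && (k <= x.2)%N) D.

Inductive indecomposable : diagram -> Prop :=
| Indec_even p : indecomposable [mset (false, (4 * p).+1)]%mset
| Indec_odd p : (0 < p)%N -> indecomposable [mset (true, (4 * p).-1)]%mset
| Indec_even2 p : (0 < p)%N ->
    indecomposable [mset (false, (4 * p).-1); (false, (4 * p).-1)]%mset
| Indec_odd2 p :
    indecomposable [mset (true, (4 * p).+1); (true, (4 * p).+1)]%mset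
| Indec_mixed p : (0 < p)%N ->
    indecomposable [mset (false, (2 * p)%N); (true, (2 * p)%N)]%mset.

Inductive admissible : diagram -> Prop :=
| Admissible0 : admissible mset0
| AdmissibleD D1 D2 :
    indecomposable D1 -> admissible D2 -> admissible (D1 `+` D2)%mset.

Definition has_parity (D : diagram) (e : bool) : Prop :=
  exists l : nat,
    (boxes false D)%:Z = (2 * l)%N%:Z + (-1) ^+ e /\ boxes true D = (2 * l)%N.

Definition drop_first (x : line) : line := (~~ x.1, x.2.-1).
Definition drop_last (x : line) : line := (x.1, x.2.-1).

Definition line_diagram (x : line) : diagram :=
  if x.2 == 0%N then mset0 else [mset x]%mset.

(* [D'] is obtained from [D] by removing the first box of a line and the last
   box of a line of the same length, either one and the same line or two
   different ones.  In the first case the two boxes must also be distinct: this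
   is ensured by the box count in [admissible_subdiagram]. *)
Definition remove_ends (D D' : diagram) : Prop :=
  (exists (x : line) (D0 : diagram),
     D = (x +` D0)%mset /\
     D' = (line_diagram (drop_first (drop_last x)) `+` D0)%mset)
  \/
  (exists (x y : line) (D0 : diagram),
     [/\ x.2 = y.2,
         D = ([mset x; y] `+` D0)%mset &
         D' = (line_diagram (drop_first x) `+` line_diagram (drop_last y)
               `+` D0)%mset]).

Definition admissible_subdiagram (D D' : diagram) : Prop :=
  [/\ admissible D,
      admissible D',
      (boxes false D + boxes true D = boxes false D' + boxes true D' + 2)%N,
      exists e : bool, has_parity D e /\ has_parity D' (~~ e) &
      remove_ends D D'].

Definition slicings (n : nat) (D : diagram) : set ((2 * n).+1.-tuple diagram) :=
  [set Ds : (2 * n).+1.-tuple diagram |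
    [/\ admissible D,
        diagram_size D = ((2 * n).+1, (2 * n)%N),
        nth mset0 Ds 0 = D &
        forall i, (1 <= i <= 2 * n)%N ->
          admissible_subdiagram (nth mset0 Ds i.-1) (nth mset0 Ds i)]]%classic.

Arguments slicings n D : clear implicits.

Section DiagramOf.
Variables (K : fieldType) (V : vectType K).
(* The grading: [Vg false] is V_0 and [Vg true] is V_1. *)
Variables (Vg : bool -> {vspace V}) (X : 'End(V)).

Definition lfun_pow (k : nat) : 'End(V) := iter k (comp_lfun X) \1%VF.

Definition nilpotent : Prop := exists k, lfun_pow k = 0.

(* dim (ker X \cap Im X^(k-1) \cap V_e), for k >= 1 *)
Definition ker_im_dim (e : bool) (k : nat) : nat :=
  \dim (lker X :&: limg (lfun_pow k.-1) :&: Vg e)%VS.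

(* The diagram with [ker_im_dim e k] lines of parity [e] and length at least k,
   see [lines_ge_diagram_of]. *)
Definition diagram_of : diagram :=
  seq_mset (flatten
    [seq nseq (ker_im_dim e k - ker_im_dim e k.+1) (e, k)
    | e <- [:: false; true], k <- iota 1 (\dim {:V})]).

Lemma limg_lfun_powS k : limg (lfun_pow k.+1) = (X @: limg (lfun_pow k))%VS.
Proof. by rewrite /lfun_pow iterS limg_comp. Qed.

Lemma limg_lfun_pow_leq i j : (i <= j)%N ->
  (limg (lfun_pow j) <= limg (lfun_pow i))%VS.
Proof.
move=> /subnK <-; elim: (j - i)%N => [|d IHd]; first exact: subvv.
apply: subv_trans IHd; rewrite addSn; elim: (d + i)%N => [|m IHm].
  by rewrite [lfun_pow 0]/= lim1g subvf.
by have := limgS X IHm; rewrite -!limg_lfun_powS.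
Qed.

Lemma ker_im_dim_leq e i j : (i <= j)%N ->
  (ker_im_dim e j <= ker_im_dim e i)%N.
Proof.
move=> ij; apply: dimvS; apply: capvS (subvv _); apply: capvS (subvv _) _.
by apply: limg_lfun_pow_leq; case: i j ij => [|i] [].
Qed.

Lemma dim_limg_lfun_pow k : nilpotent ->
  (\dim (limg (lfun_pow k)) <= \dim {:V} - k)%N.
Proof.
case=> N XN0; elim: k => [|k IHk]; first by rewrite subn0 dimvS ?subvf.
have le_k := limg_lfun_pow_leq (leqnSn k).
have [eq_k|] := eqVneq (limg (lfun_pow k.+1)) (limg (lfun_pow k)); last first.
  move=> ne_k; rewrite subnS -ltnS.
  have lt_k : (\dim (limg (lfun_pow k.+1)) < \dim (limg (lfun_pow k)))%N.
    by rewrite ltnNge; apply: contra ne_k => ?; rewrite eqEdim le_k.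
  by have := leq_trans lt_k IHk; case: (\dim {:V} - k)%N.
have stable m : limg (lfun_pow (m + k)) = limg (lfun_pow k).
  by elim: m => [|m IHm] //; rewrite addSn limg_lfun_powS IHm -limg_lfun_powS.
have := limg_lfun_pow_leq (leq_addr k N).
by rewrite stable XN0 lim0g subv0 -eq_k => /eqP ->; rewrite dimv0.
Qed.

Lemma lines_ge_diagram_of e k : nilpotent -> (0 < k)%N ->
  lines_ge diagram_of e k = ker_im_dim e k.
Proof.
move=> nilX k0; pose d : nat := \dim {:V}.
have dim0 m : (d < m)%N -> ker_im_dim e m = 0%N.
  case: m => // m; rewrite ltnS => dm; apply/eqP; rewrite -leqn0.
  apply: leq_trans (_ : \dim (limg (lfun_pow m)) <= 0)%N.
    by apply/dimvS/(subv_trans (capvSl _ _))/capvSr.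
  by rewrite (leq_trans (dim_limg_lfun_pow m nilX)) // leqn0 subn_eq0.
have cnt b s : count (fun x : line => (x.1 == e) && (k <= x.2)%N)
      (flatten [seq nseq (ker_im_dim b i - ker_im_dim b i.+1) (b, i) | i <- s])
    = (\sum_(i <- s | (b == e) && (k <= i))
         (ker_im_dim b i - ker_im_dim b i.+1))%N.
  elim: s => [|i s IHs] /=; first by rewrite big_nil.
  by rewrite count_cat IHs count_nseq /= big_cons; case: ifP;
    rewrite ?mul1n ?mul0n.
have tele m : (\sum_(i <- iota 1 m | k <= i)
      (ker_im_dim e i - ker_im_dim e i.+1)
    = ker_im_dim e k - ker_im_dim e (maxn k m.+1))%N.
  elim: m => [|m IHm]; first by rewrite big_nil (maxn_idPl k0) subnn.
  have -> : iota 1 m.+1 = rcons (iota 1 m) m.+1.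
    by rewrite -{1}(addn1 m) iotaD add1n cats1.
  rewrite big_rcons IHm /=.
  case: (ltngtP k m.+1) => [km|km|->].
  - rewrite (maxn_idPr (leqW (ltnW km))).
    by rewrite addnBA ?subnK ?ker_im_dim_leq // ltnW.
  - by rewrite (maxn_idPl km) subnn.
  - by rewrite (maxn_idPr (leqnSn _)) subnn.
rewrite /lines_ge (permP (perm_eq_seq_mset _)) /= flatten_cat count_cat.
rewrite cats0 !cnt.
have lost : ker_im_dim e (maxn k d.+1) = 0%N by rewrite dim0 // leq_maxr.
by case: e tele lost {dim0 cnt} => /= tele lost;
  rewrite tele lost subn0 big_pred0_eq ?addn0.
Qed.

End DiagramOf.

Section Orthosymplectic.
Variables (K : fieldType) (V : vectType K).
Variables (Vg : bool -> {vspace V}) (B : {biscalar V}).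

Record osp_space (m r : nat) : Prop := OspSpace {
  osp_direct : (Vg false :&: Vg true = 0)%VS;
  osp_full : (Vg false + Vg true = fullv)%VS;
  osp_dim0 : \dim (Vg false) = m;
  osp_dim1 : \dim (Vg true) = (2 * r)%N;
  osp_orth : forall x y, x \in Vg false -> y \in Vg true ->
    B x y = 0 /\ B y x = 0;
  osp_sym : forall x y, x \in Vg false -> y \in Vg false -> B x y = B y x;
  osp_alt : forall x, x \in Vg true -> B x x = 0;
  osp_nondeg : forall e x, x \in Vg e ->
    (forall y, y \in Vg e -> B x y = 0) -> x = 0 }.

(* X = (u, u^* ) with u^* = phi^-1 o u^t o psi, that is,
   phi (u^* y) = psi y o u for y in V_1, where phi and psi are x |-> B x _. *)
Record osp_odd (X : 'End(V)) : Prop := OspOdd {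
  osp_odd_grade : forall e, (X @: Vg e <= Vg (~~ e))%VS;
  osp_odd_adj : forall x y, x \in Vg false -> y \in Vg true ->
    B (X y) x = B y (X x) }.

Definition orth (W : {vspace V}) : {vspace V} :=
  (\bigcap_(w <- vbasis W) lker (linfun (fun v : V => B v w : K^o)))%VS.

Lemma orthP (W : {vspace V}) (v : V) :
  reflect (forall w, w \in W -> B v w = 0) (v \in orth W).
Proof.
have lkP w : (v \in lker (linfun (fun v : V => B v w : K^o))) = (B v w == 0).
  have lin : linear (fun v : V => B v w : K^o).
    by move=> a x y; rewrite linearPl.
  pose f : {linear V -> K^o} :=
    HB.pack (fun v : V => B v w : K^o) (GRing.isLinear.Build _ _ _ _ _ lin).
  by rewrite memv_ker (_ : linfun _ = linfun f) // lfunE.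
have inE : (v \in orth W) = all (fun w => B v w == 0) (vbasis W).
  rewrite /orth; elim: (tval (vbasis W)) => [|w s IHs] /=.
    by rewrite big_nil memvf.
  by rewrite big_cons memv_cap IHs lkP.
rewrite inE; apply: (iffP allP) => [H w /coord_vbasis -> | H w ws].
  rewrite linear_sumr big1 // => i _; rewrite linearZr /=.
  by rewrite (eqP (H _ (mem_nth 0 _))) ?mulr0 // size_tuple.
by apply/eqP/H/vbasis_mem.
Qed.

End Orthosymplectic.

(* U / W for W <= U, realized on a complement of W in U; [quot_proj] is the
   projection U -> U / W, extended to V. *)
Section Quotient.
Variables (K : fieldType) (V : vectType K) (U W : {vspace V}).

Definition quot : vectType K := subvs_of (U :\: W)%VS.

Definition quot_proj : 'Hom(V, quot) :=
  (linfun (vsproj (U :\: W)) \o addv_pi1 U W)%VF.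

Definition quot_grading (Vg : bool -> {vspace V}) (e : bool) : {vspace quot} :=
  (quot_proj @: (U :&: Vg e))%VS.

Definition quot_end (X : 'End(V)) : 'End(quot) :=
  (quot_proj \o X \o linfun (@vsval _ _ (U :\: W)%VS))%VF.

Lemma quot_projE v : vsval (quot_proj v) = addv_pi1 U W v.
Proof. by rewrite comp_lfunE lfunE /= vsprojK // memv_pi. Qed.

Lemma quot_proj_eq0 v : (W <= U)%VS -> v \in U ->
  (quot_proj v == 0) = (v \in W).
Proof.
move=> WU vU; have UW : v \in (U + W)%VS by rewrite (addv_idPl WU).
rewrite -(inj_eq subvs_inj) quot_projE linear0.
have e := addv_pi1_pi2 UW; apply/eqP/idP => [p0|vW].
  by rewrite -e p0 add0r memv_pi2.
by apply: (addIr v); rewrite add0r -{2}(addv_pi2_id U vW).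
Qed.

Lemma quot_proj_surj q : exists2 v, v \in U & quot_proj v = q.
Proof.
exists (vsval q); first exact: (subvP (diffvSl U W)) (subvsP q).
apply: subvs_inj; rewrite quot_projE.
by apply: daddv_pi_id; [exact: capv_diff | exact: subvsP].
Qed.

Lemma quot_endE (X : 'End(V)) v :
    (W <= U)%VS -> (X @: U <= U)%VS -> (X @: W <= W)%VS -> v \in U ->
  quot_end X (quot_proj v) = quot_proj (X v).
Proof.
move=> WU XU XW vU; have UW : v \in (U + W)%VS by rewrite (addv_idPl WU).
have dW : addv_pi1 U W v - v \in W.
  by rewrite -{2}(addv_pi1_pi2 UW) opprD addrA subrr add0r memvN memv_pi2.
have XdW : X (addv_pi1 U W v - v) \in W by exact: (subvP XW) (memv_img X dW).
have -> : quot_end X (quot_proj v) = quot_proj (X (addv_pi1 U W v)).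
  rewrite -quot_projE /quot_end; do 2 rewrite comp_lfunE.
  by congr (quot_proj (X _)); rewrite lfunE.
rewrite -[in LHS](subrK v (addv_pi1 U W v)) linearD [LHS]linearD /=.
have XdU := subvP WU _ XdW.
by move: XdW; rewrite -quot_proj_eq0 // => /eqP ->; rewrite add0r.
Qed.

End Quotient.

Section SpringerFiber.
Variables (K : fieldType) (V : vectType K) (n : nat).
Variables (Vg : bool -> {vspace V}) (B : {biscalar V}) (X : 'End(V)).

(* A flag E_0, ..., E_n, where E_0 = 0. *)
Definition flag := n.+1.-tuple {vspace V}.

Definition flag_comp (E : flag) (i : nat) : {vspace V} := nth 0%VS E i.

Definition isotropic_flag (e : bool) (E : flag) : Prop :=
  (forall i, (i <= n)%N ->
     [/\ \dim (flag_comp E i) = i, (flag_comp E i <= Vg e)%VS &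
         (flag_comp E i <= orth B (flag_comp E i))%VS]) /\
  (forall i, (1 <= i <= n)%N -> (flag_comp E i.-1 <= flag_comp E i)%VS).

Definition springer_fiber : set (flag * flag) :=
  [set P | [/\ isotropic_flag false P.1, isotropic_flag true P.2 &
    forall i, (1 <= i <= n)%N ->
      (X @: flag_comp P.1 i <= flag_comp P.2 i.-1)%VS /\
      (X @: flag_comp P.2 i <= flag_comp P.1 i)%VS]]%classic.

(* The diagram of the endomorphism induced by X on W^\perp / W. *)
Definition induced_diagram (W : {vspace V}) : diagram :=
  diagram_of (quot_grading (orth B W) W Vg) (quot_end (orth B W) W X).

Definition springer_stratum (Ds : (2 * n).+1.-tuple diagram) :
    set (flag * flag) :=
  [set P | springer_fiber P /\
    forall i, (1 <= i <= n)%N ->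
      induced_diagram (flag_comp P.1 i + flag_comp P.2 i.-1)%VS
        = nth mset0 Ds (2 * i).-1 /\
      induced_diagram (flag_comp P.1 i + flag_comp P.2 i)%VS
        = nth mset0 Ds (2 * i)]%classic.

(* The Zariski topology.  The variety of flags (E_1 < ... < E_n) of V_e, with dim E_i = i, is the
   quotient of the variety of linearly independent n-tuples of vectors of V_e
   by the action of the invertible triangular matrices, and it has the
   quotient topology.  The same holds for pairs of flags. *)

Definition is_frame (e : bool) (v : n.-tuple V) : Prop :=
  free v /\ forall i, tnth v i \in Vg e.

Definition frame_flag (v : n.-tuple V) : flag :=
  [tuple <<take i v>>%VS | i < n.+1].

Definition frame_coords (v w : n.-tuple V) : 'I_((n + n) * \dim {:V}) -> K :=
  fun k => mxvec (\matrix_(i < n + n, j < \dim {:V})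
             coord (vbasis {:V}) j (tnth (cat_tuple v w) i)) 0 k.

Definition zariski_closed (Z : set (flag * flag)) : Prop :=
  exists I : set {mpoly K[(n + n) * \dim {:V}]},
    forall v w, is_frame false v -> is_frame true w ->
      Z (frame_flag v, frame_flag w) <->
      (forall p, I p -> p.@[frame_coords v w] = 0).

Definition locally_closed_in (Y S : set (flag * flag)) : Prop :=
  exists Z O : set (flag * flag),
    [/\ zariski_closed Z, zariski_closed (~` O)%classic &
        S = (Y `&` (Z `&` O))%classic].

End SpringerFiber.

Arguments springer_fiber {K V} n Vg B X.
Arguments springer_stratum {K V} n Vg B X Ds.

(* Main.v *)
Require Import Defs.
From HB Require Import structures.
From mathcomp Require Import all_boot all_order all_algebra.
From mathcomp Require Import finmap multiset mpoly complex.
From mathcomp Require Import boolp classical_sets reals.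
From mathcomp Require Import zify.

(* Since X is odd, the diagram D(X) and the ranks of the maps
   X^j : V_(e+j) -> V_e determine each other.  If w is a homogeneous isotropic
   vector of ker X, lying in Im X^(k-1) but not in Im X^k, then restricting to
   w^\perp and dividing by w decreases the rank of X^j by 1 when V_e is the
   target, and by 1 when V_e is the source, as long as j < k.  The only exception
   is a decrease by 1 instead of 2, when k is odd, j = k - 1 and
   w = X^(k-1) v with B(v, w) <> 0.  On the diagram, this
   removes the first box of a line of length k and the last box of a line of
   length k, the same line in the exceptional case.  Diagrams of orthosymplectic
   nilpotents are admissible because the forms B(x, X^j y) on V_e have ranks
   with the right parity and because X^j is, up to sign, its own adjoint.
   Hence the diagrams of the successive quotients along a pair of flags form an
   admissible slicing.  Finally, for W spanned by members of the two flags, the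
   rank of X^j on the quotient of W^\perp by W is, up to a constant, the rank of
   a bordered matrix whose entries are polynomials in the frames, so that each
   stratum is cut out by finitely many conditions that a rank be constant. *)

Set Implicit Arguments.
Unset Strict Implicit.
Unset Printing Implicit Defensive.

Import GRing.Theory.
Local Open Scope ring_scope.
Local Open Scope classical_set_scope.
Import passmx.

(** * Diagrams and rank functions *)

(* [r e j] stands for dim (Im X^j \cap V_e). *)
Definition rank_diagram (r : bool -> nat -> nat) (D : diagram) : Prop :=
  (forall e, D (e, 0%N) = 0%N) /\
  (forall e k, lines_ge D e k.+1 + r (~~ e) k.+1 = r e k)%N.

Lemma lines_geS (D : diagram) e k :
  lines_ge D e k = (D (e, k) + lines_ge D e k.+1)%N.
Proof.
rewrite /lines_ge -(count_mem_mset (e, k) D).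
elim: (enum_mset D) => //= -[b l] s ->; rewrite xpair_eqE /=.
by case: (b == e) => /=; lia.
Qed.

(** The number of lines of one exact length is a second difference of [r]. Only sums occur, since
    subtraction on naturals truncates. *)
Lemma rank_diagram_mult r D : rank_diagram r D -> forall e k,
  (D (e, k.+1) + r (~~ e) k.+1 + r e k.+1 = r e k + r (~~ e) k.+2)%N.
Proof.
case=> _ Dr e k; move: (lines_geS D e k.+1) (Dr e k) (Dr e k.+1).
by move: (D _) => d; lia.
Qed.

(** A diagram fixes only the differences [r e k - r (~~ e) k.+1]; a common vanishing bound anchors a
    descending induction. *)
Lemma rank_diagram_inj r r' D N :
  (forall e j, (N <= j)%N -> r e j = 0%N) ->
  (forall e j, (N <= j)%N -> r' e j = 0%N) ->
  rank_diagram r D -> rank_diagram r' D -> r =2 r'.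
Proof.
move=> r0 r'0 [_ Dr] [_ Dr'].
suff H m : forall e j, (N <= j + m)%N -> r e j = r' e j.
  by move=> e j; apply: (H N); rewrite leq_addl.
elim: m => [|m IHm] e j; first by rewrite addn0 => Nj; rewrite r0 ?r'0.
by rewrite addnS -addSn -Dr -Dr' => Nj; rewrite IHm.
Qed.

Lemma rank_diagram_uniq r D D' :
  rank_diagram r D -> rank_diagram r D' -> D = D'.
Proof.
move=> rD rD'; apply/msetP => -[e [|k]]; first by rewrite rD.1 rD'.1.
move: (rank_diagram_mult rD e k) (rank_diagram_mult rD' e k).
by move: (D _) (D' _) => a b; lia.
Qed.

(** Labels alternate, so the box at position i, counted from 0, carries [d] exactly when the first
    label is d + i modulo 2. The common bound [N] lets the sums over lines and positions be
    exchanged. *)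
Lemma line_boxes_sum d (x : line) N : (x.2 <= N)%N ->
  line_boxes d x = (\sum_(0 <= i < N) ((x.1 == d (+) odd i) && (i < x.2)))%N.
Proof.
case: x => e l /= lN; rewrite (big_cat_nat (n := l)) //=.
rewrite [X in (_ + X)%N]big1_seq ?addn0; last first.
  by move=> i; rewrite mem_index_iota => /andP[_ /andP[li _]]; lia.
elim: l {lN} => [|l IHl]; first by rewrite big_nil /line_boxes /= if_same.
rewrite big_nat_recr //= ltnSn andbT.
under eq_big_nat => i /andP[_ il].
  rewrite (_ : (i < l.+1) = (i < l))%N; last by lia. over.
rewrite -IHl /line_boxes /= !uphalf_half /=.
by move=> {IHl}; case: e; case: d => /=; lia.
Qed.

(** Boxes are counted column by column: those labelled [d] in column i number
    [lines_ge D (d (+) odd i) i.+1], a difference of consecutive ranks, and the sum telescopes. *)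
Lemma boxes_ranks r D N : (forall e j, (N <= j)%N -> r e j = 0%N) ->
  rank_diagram r D -> forall d, boxes d D = r d 0%N.
Proof.
move=> r0 [D0 Dr] d.
have DN x : x \in D -> (x.2 <= N)%N.
  case: x => e l; rewrite leqNgt => xD; apply/negP => /= Nl.
  have: (0 < lines_ge D e N.+1)%N.
    by rewrite -has_count; apply/hasP; exists (e, l); rewrite //= eqxx.
  by have := Dr e N; rewrite !r0 //; lia.
rewrite /boxes (eq_big_seq _ (fun x xD => line_boxes_sum d (DN x xD))) exchange_big
  /=.
have lE i : (\sum_(x <- D) ((x.1 == d (+) odd i) && (i < x.2)))%N = lines_ge D (d
  (+) odd i) i.+1.
rewrite /lines_ge -sum1_count [RHS]big_mkcond; apply: eq_bigr => x _.
  by case: (_ && _).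
under eq_bigr => i _ do rewrite lE.
have H M : (\sum_(0 <= i < M) lines_ge D (d (+) odd i) i.+1 + r (d (+) odd M) M = r
  d 0)%N.
  elim: M => [|M IHM]; first by rewrite big_nil addbF.
  rewrite big_nat_recr //= -IHM -(Dr _ M); case: (odd M);
    rewrite /= ?addbT ?addbF ?negbK; lia.
by rewrite -(H N) r0 // addn0.
Qed.

(** * Admissibility read off multiplicities and ranks *)

Lemma perm_msetD (A B : diagram) : perm_eq (A `+` B)%mset (A ++ B).
Proof.
apply/eq_seq_msetP; rewrite seq_mset_id; apply/msetP => x.
by rewrite mset_seqE count_cat !count_mem_mset msetE2.
Qed.

(** Lines are removed greedily: the hypotheses place any line of [D] in an indecomposable
    subdiagram, whose removal preserves them, so strong induction on the number of lines applies. *)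
Lemma admissible_mult (D : diagram) :
  (forall e, D (e, 0%N) = 0%N) ->
  (forall l, ~~ odd l -> D (false, l) = D (true, l)) ->
  (forall l, l %% 4 = 3 -> ~~ odd (D (false, l)))%N ->
  (forall l, l %% 4 = 1 -> ~~ odd (D (true, l)))%N -> admissible D.
Proof.
have [m] := ubnP (size D); elim: m D => // m IHm D;
  rewrite ltnS => szD D0 Dev D3 D1.
have [->|[[e l] xD]] := mset_0Vmem D; first exact: Admissible0.
have step I x : indecomposable I -> x \in I -> (I `<=` D)%mset ->
    (forall e, I (e, 0%N) = 0%N) ->
    (forall l, ~~ odd l -> I (false, l) = I (true, l)) ->
    (forall l, l %% 4 = 3 -> ~~ odd (I (false, l)))%N ->
    (forall l, l %% 4 = 1 -> ~~ odd (I (true, l)))%N -> admissible D.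
  move=> indI xI ID I0 Iev I3 I1; rewrite -(msetBDKC ID).
  have IP := elimT msubsetP ID.
  apply: AdmissibleD => //; apply: IHm => [|b|k ok|k k3|k k1]; rewrite ?msetE2.
  - apply: leq_trans szD; rewrite -{2}(msetBDKC ID) (perm_size (perm_msetD _ _)).
    rewrite size_cat -[X in (X < _)%N]add0n ltn_add2r.
    by rewrite -has_predT; apply/hasP; exists x.
  - by rewrite D0.
  - by rewrite Dev // Iev.
  - by rewrite oddB ?IP // (negbTE (D3 _ k3)) (negbTE (I3 _ k3)).
  - by rewrite oddB ?IP // (negbTE (D1 _ k1)) (negbTE (I1 _ k1)).
have l0 : (0 < l)%N by case: l xD => // xD; move: xD; rewrite -mset_gt0 D0.
rewrite -mset_gt0 in xD.
have sub2 (x y : line) : (0 < D x)%N -> (0 < D y)%N -> (x == y -> 1 < D x)%N ->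
  ([mset x; y] `<=` D)%mset.
  move=> Dx Dy Dxy; apply/msubsetP => z; rewrite mset1DE msetnE.
  case: (z =P x) => [->|_]; last by case: eqVneq => [->|].
  by case: (x == y) Dxy => [->|].
have memE x y z : ([mset x; y]%mset : diagram) z = ((z == x) + (z == y))%N.
  by rewrite mset1DE msetnE; case: (z == y).
have mem1E x z : ([mset x]%mset : diagram) z = (z == x).
  by rewrite msetnE; case: (z == x).
have [el|ol] := boolP (~~ odd l).
  have /Dev De := el.
  apply: (step [mset (false, l); (true, l)]%mset (false, l)).
  - have -> : l = (2 * l./2)%N by lia.
    by apply: Indec_mixed; lia.
  - by rewrite mset1D1.
  - by apply: sub2 => //; case: e xD; rewrite -?De // De.
  - by move=> b; rewrite memE !xpair_eqE; lia.
  - by move=> k ok; rewrite !memE !xpair_eqE /=; lia.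
  - by move=> k ok; rewrite !memE !xpair_eqE /=; lia.
  - by move=> k ok; rewrite !memE !xpair_eqE /=; lia.
have [l1|l3] : (l %% 4 = 1 \/ l %% 4 = 3)%N by lia.
- have lE : l = (4 * (l %/ 4)).+1%N by lia.
  case: e xD => xD.
    apply: (step [mset (true, l); (true, l)]%mset (true, l)).
    - by rewrite lE; apply: Indec_odd2.
    - by rewrite mset1D1.
    - by apply: sub2 => // _; case: (D _) (D1 _ l1) xD => [|[]].
    - by move=> b; rewrite memE !xpair_eqE; lia.
    - by move=> k ok; rewrite !memE !xpair_eqE /=; lia.
    - by move=> k ok; rewrite !memE !xpair_eqE /=; lia.
    - by move=> k ok; rewrite !memE !xpair_eqE /=; lia.
  apply: (step [mset (false, l)]%mset (false, l)).
  - by rewrite lE; apply: Indec_even.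
  - by rewrite mset11.
  - by rewrite msub1set -mset_gt0.
  - by move=> b; rewrite mem1E !xpair_eqE; lia.
  - by move=> k ok; rewrite !mem1E !xpair_eqE /=; lia.
  - by move=> k ok; rewrite !mem1E !xpair_eqE /=; lia.
  - by move=> k ok; rewrite !mem1E !xpair_eqE /=; lia.
- have lE : l = (4 * (l %/ 4).+1).-1%N by lia.
  case: e xD => xD; last first.
    apply: (step [mset (false, l); (false, l)]%mset (false, l)).
    - by rewrite lE; apply: Indec_even2.
    - by rewrite mset1D1.
    - by apply: sub2 => // _; case: (D _) (D3 _ l3) xD => [|[]].
    - by move=> b; rewrite memE !xpair_eqE; lia.
    - by move=> k ok; rewrite !memE !xpair_eqE /=; lia.
    - by move=> k ok; rewrite !memE !xpair_eqE /=; lia.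
    - by move=> k ok; rewrite !memE !xpair_eqE /=; lia.
  apply: (step [mset (true, l)]%mset (true, l)).
  - by rewrite lE; apply: Indec_odd.
  - by rewrite mset11.
  - by rewrite msub1set -mset_gt0.
  - by move=> b; rewrite mem1E !xpair_eqE; lia.
  - by move=> k ok; rewrite !mem1E !xpair_eqE /=; lia.
  - by move=> k ok; rewrite !mem1E !xpair_eqE /=; lia.
  - by move=> k ok; rewrite !mem1E !xpair_eqE /=; lia.
Qed.

(** By the second difference formula: for even lengths the two labels enter symmetrically; for odd
    lengths the two middle terms are equal, and the outer terms are even in the congruence classes
    concerned. *)
Lemma admissible_ranks r D : rank_diagram r D ->
  (forall j, odd j -> r false j = r true j) ->
  (forall j, j %% 4 = 2 -> ~~ odd (r false j))%N ->
  (forall j, j %% 4 = 0 -> ~~ odd (r true j))%N -> admissible D.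
Proof.
move=> rD rodd r2 r0; have Dr := rank_diagram_mult rD.
apply: admissible_mult; first exact: rD.1.
- case=> [|l] ol; first by rewrite !rD.1.
  have := Dr false l; have := Dr true l; rewrite /= in ol *.
  have := rodd l; have := rodd l.+2; rewrite /= => h2 h0.
  by rewrite h2 ?h0 //; [move: (D (true, _)) (D (false, _)) => a b; lia | lia].
- case=> // l l3; have := Dr false l; move: (D _) => d /=.
  have := r2 l; have := r0 l.+2; have := rodd l.+1 => /= h1 h2 h3.
  have {}h1 : r false l.+1 = r true l.+1 by apply: h1; lia.
  have {}h2 : ~~ odd (r true l.+2) by apply: h2; lia.
  have {}h3 : ~~ odd (r false l) by apply: h3; lia.
  by lia.
- case=> // l l3; have := Dr true l; move: (D _) => d /=.
  have := r2 l.+2; have := r0 l; have := rodd l.+1 => /= h1 h2 h3.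
  have {}h1 : r false l.+1 = r true l.+1 by apply: h1; lia.
  have {}h2 : ~~ odd (r true l) by apply: h2; lia.
  have {}h3 : ~~ odd (r false l.+2) by apply: h3; lia.
  by lia.
Qed.

(** * Removing a first and a last box *)

Lemma line_diagramE (x y : line) :
  (line_diagram x : diagram) y = ((y == x) && (x.2 != 0%N)).
Proof.
rewrite /line_diagram; case: (x.2 == 0%N); first by rewrite mset0E andbF.
by rewrite msetnE andbT; case: (y == x).
Qed.

(* The decrease of dim (Im X^j \cap V_e') under reduction by a vector w in V_e
   with w in Im X^(k-1) but not in Im X^k; [b] is the exceptional case, where
   the two removed boxes lie on the same line. *)
Definition end_drop (e : bool) (k : nat) (b e' : bool) (j : nat) : nat :=
  (((j < k) && (e' == e)) + ((j < k) && (e' (+) odd j == e))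
   - (b && (e' == e) && (j == k.-1)))%N.

Ltac nat_tests := repeat match goal with
  | |- context [leq ?m ?n] =>
    first [rewrite (_ : leq m n = true); last lia | rewrite (_ : leq m n = false);
      last lia]
  | |- context [@eq_op _ ?m ?n] => let mn := constr:(leq m n) in
    first [rewrite (_ : (m == n) = true);
      last lia | rewrite (_ : (m == n) = false); last lia]
  end.

(** The second differences of [end_drop] are the changes of multiplicity: [(e, k)] loses its first
    box and [(f, k)] its last, where [f] is the first label of a line of length [k] that ends in
    [e]. If [b] holds, a single line [(e, k)] loses both. *)
Lemma end_drop_diff2 e k (b : bool) e' l : (0 < k)%N -> (b -> odd k && (1 < k))%N ->
  let f := e (+) ~~ odd k in
  (end_drop e k b e' l + end_drop e k b (~~ e') l.+2
   + (if b then ((e', l.+1) == (~~ e, k.-2)) : nat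
      else ((e', l.+1) == (~~ e, k.-1)) + ((e', l.+1) == (f, k.-1)))
  = end_drop e k b e' l.+1 + end_drop e k b (~~ e') l.+1
   + (if b then ((e', l.+1) == (e, k)) : nat
      else ((e', l.+1) == (e, k)) + ((e', l.+1) == (f, k))))%N.
Proof.
move=> k0 bk /=; rewrite /end_drop !xpair_eqE.
(* Only the values of [k] from l + 1 to l + 3 need separate treatment; on either side of them every
   comparison has a constant truth value. *)
have kP : [\/ (k <= l)%N, k = l.+1, k = l.+2 | k = l.+3] \/ (l.+3 < k)%N.
  have [|] := leqP k l; first by left; constructor 1.
  rewrite leq_eqVlt => /predU1P[<-|]; first by left; constructor 2.
  rewrite leq_eqVlt => /predU1P[<-|]; first by left; constructor 3.
  rewrite leq_eqVlt => /predU1P[<-|]; first by left; constructor 4.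
  by right.
case: kP => [[kl|kl|kl|kl]|kl]; rewrite ?kl.
all: nat_tests.
all: rewrite ?kl /= in bk *; case: b bk => [/(_ isT)/andP[]|_];
  case: e; case: e' => //=; case: (odd l) => //=.
Qed.

(* That [D] has enough lines of length [k] needs no hypothesis: the multiplicities
   in [D'] would otherwise be negative. *)
Lemma remove_ends_ranks r r' D D' e k (b : bool) :
  rank_diagram r D -> rank_diagram r' D' -> (0 < k)%N ->
  (b -> odd k && (1 < k))%N ->
  (forall e' j, (r' e' j + end_drop e k b e' j = r e' j)%N) ->
  remove_ends D D'.
Proof.
move=> rD rD' k0 bk rr'; pose f := e (+) ~~ odd k.
have Dr := rank_diagram_mult rD; have Dr' := rank_diagram_mult rD'.
case: b bk rr' => [/(_ isT)/andP[ok k1]|_] rr'.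
  left; exists (e, k), (D `\ (e, k))%mset.
  (* Comparing the second differences of [r] and [r'] compares multiplicities. The test on [z.2]
     reflects that [line_diagram] discards an emptied line. *)
  have DD' z : (D' z + (z == (e, k)) = D z + ((z == (~~ e, k.-2)) && (z.2 != 0)))%N.
    case: z => e' [|l]; first by rewrite rD.1 rD'.1 !xpair_eqE; lia.
    have bk : true -> odd k && (1 < k)%N by rewrite ok k1.
    have /= := end_drop_diff2 e e' l k0 bk.
    move: (rr' e' l) (rr' e' l.+1) (rr' (~~ e') l.+1) (rr' (~~ e') l.+2).
    rewrite andbT; move: (Dr e' l) (Dr' e' l); move: (D _) (D' _) => d d'.
    move: (end_drop _ _ _ _ _) (end_drop _ _ _ _ _) (end_drop _ _ _ _ _) (end_drop
      _ _ _ _ _).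
    by move: (nat_of_bool _) (nat_of_bool _) {rr' rD rD' Dr Dr'} => b1 b2 *; lia.
  have Dek : (e, k) \in D.
    have ee : (e == ~~ e) = false by case: (e).
    have := DD' (e, k); rewrite eqxx xpair_eqE ee -mset_gt0.
    by move: (D _) (D' _) => d d'; lia.
  split; first by rewrite msetB1K.
  apply/msetP => z; have := DD' z; rewrite msetE2 msetB1E line_diagramE /=.
  have : ((z == (e, k)) <= D z)%N by case: eqP => // ->; rewrite mset_gt0.
  have -> : (z == (~~ e, k.-2)) && (k.-2 != 0%N) = (z == (~~ e, k.-2)) && (z.2 !=
    0%N).
    by case: eqP => // ->.
  by move: (D _) (D' _) (z == _) (z == _) (z.2 != _) => d d' [] [] [] /=; lia.
right; exists (e, k), (f, k), (D `\` [mset (e, k); (f, k)])%mset.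
have DD' z : (D' z + ((z == (e, k)) + (z == (f, k))) =
    D z + ((z == (~~ e, k.-1)) && (z.2 != 0) + (z == (f, k.-1)) && (z.2 != 0)))%N.
  case: z => e' [|l].
    by rewrite rD.1 rD'.1 !xpair_eqE !andbF (_ : (0%N == k) = false) ?andbF //; lia.
  have bk : false -> odd k && (1 < k)%N by [].
  have /= := end_drop_diff2 e e' l k0 bk.
  move: (rr' e' l) (rr' e' l.+1) (rr' (~~ e') l.+1) (rr' (~~ e') l.+2).
  rewrite -/f !andbT; move: (Dr e' l) (Dr' e' l); move: (D _) (D' _) => d d'.
  move: (end_drop _ _ _ _ _) (end_drop _ _ _ _ _) (end_drop _ _ _ _ _) (end_drop _
    _ _ _ _).
  move: {rr' rD rD' Dr Dr'} (nat_of_bool _) (nat_of_bool _) (nat_of_bool _)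
    (nat_of_bool _) => b1 b2 b3 b4 *; lia.
have mem1E (x z : line) : ([mset x]%mset : diagram) z = (z == x).
  by rewrite msetnE; case: (z == x).
have DS z : ((z == (e, k)) + (z == (f, k)) <= D z)%N.
  have := DD' z; have : (z == (e, k)) || (z == (f, k)) -> z.2 == k.
    by case/orP => /eqP ->.
  by case: z => e' l /=; rewrite !xpair_eqE; move: (D _) (D' _) => d d'; lia.
split => //.
  by rewrite msetBDKC //; apply/msubsetP => z; rewrite msetE2 !mem1E.
apply/msetP => z; have := DD' z; rewrite !msetE2 !mem1E !line_diagramE.
rewrite /drop_first /drop_last /=.
have := DS z.
have dE g : (z == (g, k.-1)) && (k.-1 != 0%N) = (z == (g, k.-1)) && (z.2 != 0%N).
  by case: eqP => // ->.
rewrite !dE; move: (D _) (D' _) (nat_of_bool (z == (e, k))) (nat_of_bool (z == (f,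
  k))) => d d' b1 b2.
by move: (nat_of_bool _) (nat_of_bool _) => b3 b4; lia.
Qed.

(** * Matrices of bilinear forms *)

(* [A = R^T M^T R] with [R] row free, so that [M] is skew-symmetric and
   invertible, of size the rank of [A]. *)
Lemma skew_rank_even (K : fieldType) n (A : 'M[K]_n) :
  2%:R != 0 :> K -> A^T = - A -> ~~ odd (\rank A).
Proof.
move=> K2 skewA.
have [r [C [R [rE AE]]]] : exists r (C : 'M_(n, r)) (R : 'M_(r, n)),
    [/\ r = \rank A, A = C *m R & row_free R].
  by exists (\rank A), (col_base A), (row_base A); split;
    rewrite ?mulmx_base ?row_base_free.
case/row_freeP=> R' RR'; pose M := R'^T *m A *m R'.
have skewM : M^T = - M by rewrite !trmx_mul trmxK skewA mulNmx mulmxN mulmxA.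
have CM : C = R^T *m M.
  apply: trmx_inj; rewrite trmx_mul trmxK skewM mulNmx.
  have -> : C^T = R'^T *m A^T by rewrite -trmx_mul AE -mulmxA RR' mulmx1.
  by rewrite skewA mulmxN /M AE -!mulmxA (mulmxA R R') RR' mul1mx.
have rM : \rank M = r.
  apply/eqP; rewrite eqn_leq rank_leq_row {1}rE AE CM -mulmxA.
  by rewrite (leq_trans (mxrankM_maxr _ _)) // mxrankM_maxl.
have uM : M \in unitmx by rewrite -row_free_unit /row_free rM.
(* If r were odd, this would give 2 det M = 0, against the invertibility of [M]. *)
have : \det M = (-1) ^+ r * \det M by rewrite -{1}det_tr skewM -scaleN1r detZ.
rewrite -rE -signr_odd; case: (odd r) => //=; rewrite expr1 mulN1r => /eqP.
rewrite -subr_eq0 opprK -mulr2n -mulr_natl mulf_eq0 (negbTE K2) /=.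
by move: uM; rewrite unitmxE unitfE => /negbTE ->.
Qed.

(** * Subspaces, orthogonals and images in coordinates *)

Section Coordinates.
Variables (K : fieldType) (V : vectType K).
Local Notation N := (\dim {:V}).
Local Notation e := (vbasis {:V}).

Definition coord_rows m (s : m.-tuple V) : 'M[K]_(m, N) :=
  \matrix_(i < m) rVof e (tnth s i).

Lemma mul_coord_rows m (s : m.-tuple V) (c : 'rV_m) :
  c *m coord_rows s = rVof e (\sum_i c 0 i *: s`_i).
Proof.
rewrite mulmx_sum_row linear_sum; apply: eq_bigr => i _.
by rewrite rowK linearZ (tnth_nth 0).
Qed.

Lemma sub_coord_rows m (s : m.-tuple V) v :
  (rVof e v <= coord_rows s)%MS = (v \in <<s>>%VS).
Proof.
apply/submxP/idP => [[c]|vs].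
  rewrite mul_coord_rows => /(can_inj (rVofK (vbasisP _))) ->.
  by apply: memv_suml => i _; apply/memvZ/memv_span/mem_nth; rewrite size_tuple.
exists (\row_i coord s i v); rewrite mul_coord_rows.
by congr (rVof e _); rewrite {1}(coord_span vs); apply: eq_bigr => i _; rewrite mxE.
Qed.

Lemma rank_coord_rows m (s : m.-tuple V) : \rank (coord_rows s) = \dim <<s>>.
Proof.
pose b := vbasis <<s>>.
have -> : \rank (coord_rows s) = \rank (coord_rows b).
  apply/eqmx_rank/andP; split; apply/row_subP => i; rewrite rowK sub_coord_rows.
    by rewrite (span_basis (vbasisP _)) memv_span ?mem_tnth.
  by rewrite vbasis_mem ?mem_tnth.
apply/eqP/inj_row_free => c; rewrite mul_coord_rows => /eqP.
rewrite rVof_eq0 ?vbasisP // => /eqP c0; apply/rowP => i; rewrite mxE.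
have /freeP := basis_free (vbasisP <<s>>); apply; exact: c0.
Qed.

Lemma dim_vsof (M : 'M[K]_N) : \dim (vsof e M) = \rank M.
Proof.
have eb := vbasisP {:V}.
have -> : vsof e M = <<map_tuple (hommx e e M) e>>%VS.
  by rewrite -limg_span (span_basis eb).
rewrite -rank_coord_rows; congr (\rank _); apply/row_matrixP => i.
by rewrite rowK tnth_map -rVof_mul // (tnth_nth 0) rVofE // rowE.
Qed.

Section Form.
Variable B : {biscalar V}.

Definition form_mx : 'M[K]_N := \matrix_(i, j) B e`_i e`_j.

Lemma rVof_form_mx v j : (rVof e v *m form_mx) 0 j = B v e`_j.
Proof.
rewrite mulmx_sum_row summxE [in RHS](coord_vbasis (memvf v)) linear_sumlz.
by apply: eq_bigr => i _; rewrite linearZl /= !mxE.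
Qed.

Lemma mul_form_mx v m (s : m.-tuple V) i :
  (rVof e v *m form_mx *m (coord_rows s)^T) 0 i = B v (tnth s i).
Proof.
rewrite mxE [in RHS](coord_vbasis (memvf (tnth s i))) linear_sumr.
by apply: eq_bigr => j _; rewrite rVof_form_mx linearZr /= !mxE mulrC.
Qed.

Hypothesis nondeg : forall x, (forall y, B x y = 0) -> x = 0.

Lemma form_mx_free : row_free form_mx.
Proof.
apply/inj_row_free => c cG0; have eb := vbasisP {:V}.
rewrite -[c](vecofK eb) [vecof e c]nondeg ?linear0 // => y.
rewrite (coord_vbasis (memvf y)) linear_sumr big1 // => j _.
by rewrite linearZr /= -rVof_form_mx (vecofK eb) cG0 mxE mulr0.
Qed.

Lemma orth_vsof m (s : m.-tuple V) :
  orth B <<s>> = vsof e (kermx (form_mx *m (coord_rows s)^T)).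
Proof.
apply/vspaceP => v; rewrite -rVof_sub ?vbasisP //;
  apply/orthP/sub_kermxP => [vs|vs w].
  apply/rowP => i; rewrite mulmxA mul_form_mx mxE; apply: vs.
  by rewrite memv_span ?mem_tnth.
move=> /coord_span ->; rewrite linear_sumr big1 // => i _.
by rewrite linearZr /= -tnth_nth -mul_form_mx -mulmxA vs mxE mulr0.
Qed.

Lemma rank_form_coord m (s : m.-tuple V) :
  \rank (form_mx *m (coord_rows s)^T) = \dim <<s>>.
Proof.
rewrite -mxrank_tr trmx_mul trmxK mxrankMfree ?rank_coord_rows //.
by rewrite row_free_unit unitmx_tr -row_free_unit form_mx_free.
Qed.

Lemma dim_orth W : \dim (orth B W) = (N - \dim W)%N.
Proof.
rewrite -{1}(span_basis (vbasisP W)) orth_vsof dim_vsof mxrank_ker.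
by rewrite rank_form_coord (span_basis (vbasisP W)).
Qed.

(** The matrix of the form B(x, f y) is skew-symmetric, and its rank is that of [f] because the Gram
    matrix of [B] is invertible. *)
Lemma even_dim_limg_alt (f : 'End(V)) : 2%:R != 0 :> K ->
  (forall x y, B x (f y) = - B y (f x)) -> ~~ odd (\dim (limg f)).
Proof.
move=> K2 skewf; have eb := vbasisP {:V}.
have -> : limg f = <<map_tuple f e>>%VS by rewrite -limg_span (span_basis eb).
rewrite -rank_form_coord; apply: skew_rank_even => //.
have E i j : (form_mx *m (coord_rows (map_tuple f e))^T) i j = B e`_i (f e`_j).
  have := mul_form_mx e`_i (map_tuple f e) j; rewrite rVofE // -mulmxA -rowE.
  by rewrite mxE tnth_map (tnth_nth 0).
by apply/matrixP => i j; rewrite [LHS]mxE [RHS]mxE !E skewf.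
Qed.

End Form.

End Coordinates.

(** * Ranks of the powers of an odd nilpotent endomorphism *)

Section Graded.
Variables (K : fieldType) (V : vectType K).
Variables (Vg : bool -> {vspace V}) (X : 'End(V)).

(* This is dim (Im X^j \cap V_e), as X^j maps V_(e+j) to V_e. *)
Definition graded_rank (e : bool) (j : nat) : nat :=
  \dim (lfun_pow X j @: Vg (e (+) odd j)).

Definition hproj (e : bool) : 'End(V) := daddv_pi (Vg e) (Vg (~~ e)).

Lemma lfun_powS j v : lfun_pow X j.+1 v = X (lfun_pow X j v).
Proof. by rewrite [lfun_pow X _]/= comp_lfunE. Qed.

Lemma lfun_powD i j v : lfun_pow X (i + j) v = lfun_pow X i (lfun_pow X j v).
Proof.
elim: i => [|i IHi]; first by rewrite [lfun_pow X 0]/= id_lfunE.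
by rewrite addSn !lfun_powS IHi.
Qed.

Lemma lfun_powSr j v : lfun_pow X j.+1 v = lfun_pow X j (X v).
Proof. by rewrite -addn1 lfun_powD lfun_powS [lfun_pow X 0]/= id_lfunE. Qed.

Hypothesis direct : (Vg false :&: Vg true = 0)%VS.
Hypothesis full : (Vg false + Vg true = fullv)%VS.

Lemma hdirect e : (Vg e :&: Vg (~~ e) = 0)%VS.
Proof. by case: e => //=; rewrite capvC. Qed.

Lemma hproj_mem e v : hproj e v \in Vg e.
Proof. exact: memv_pi. Qed.

Lemma hproj_add e v : hproj e v + hproj (~~ e) v = v.
Proof.
rewrite /hproj negbK; apply: daddv_pi_add; first exact: hdirect.
by case: e => /=; rewrite ?full 1?addvC ?full memvf.
Qed.

Lemma hproj_id e v : v \in Vg e -> hproj e v = v.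
Proof. by move=> ve; apply: daddv_pi_id => //; apply: hdirect. Qed.

Lemma hproj0 e v : v \in Vg (~~ e) -> hproj e v = 0.
Proof.
move=> ve; apply: (addIr (hproj (~~ e) v)).
by rewrite hproj_add add0r hproj_id.
Qed.

Lemma hproj_limg e : limg (hproj e) = Vg e.
Proof.
apply/vspaceP => v; apply/memv_imgP/idP => [[u _ ->]|ve]; first exact: hproj_mem.
by exists v; rewrite ?memvf ?hproj_id.
Qed.

Lemma hdim : (\dim (Vg false) + \dim (Vg true))%N = \dim {:V}.
Proof. by rewrite -full dimv_disjoint_sum. Qed.

Hypothesis grade : forall e, (X @: Vg e <= Vg (~~ e))%VS.

Lemma grade_mem e v : v \in Vg e -> X v \in Vg (~~ e).
Proof. by move=> ve; apply: (subvP (grade e)); apply: memv_img. Qed.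

Lemma grade_pow e j v : v \in Vg (e (+) odd j) -> lfun_pow X j v \in Vg e.
Proof.
elim: j e => [|j IHj] e /=; first by rewrite id_lfunE addbF.
by rewrite addbN -addNb comp_lfunE => /IHj/grade_mem; rewrite negbK.
Qed.

Lemma hproj_grade e v : hproj e (X v) = X (hproj (~~ e) v).
Proof.
rewrite -{1}(hproj_add e v) !linearD /= (hproj0 (grade_mem (hproj_mem e v))).
by rewrite add0r hproj_id //; have := grade_mem (hproj_mem (~~ e) v); rewrite negbK.
Qed.

Lemma hproj_pow e j v : hproj e (lfun_pow X j v) = lfun_pow X j (hproj (e (+) odd
  j) v).
Proof.
elim: j e => [|j IHj] e; first by rewrite [lfun_pow X 0]/= !id_lfunE addbF.
by rewrite !lfun_powS hproj_grade IHj /= addbN addNb.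
Qed.

(** Rank-nullity for X on Im X^k \cap V_e, which equals X^k(V_(e+k)). *)
Lemma ker_im_dimE e k :
  (ker_im_dim Vg X e k.+1 + graded_rank (~~ e) k.+1 = graded_rank e k)%N.
Proof.
rewrite /ker_im_dim /graded_rank /= addNb addbN negbK limg_comp -[RHS](limg_ker_dim
  X).
congr (\dim _ + _)%N; rewrite -capvA capvC; congr (_ :&: _)%VS.
apply/vspaceP => v; rewrite memv_cap; apply/andP/memv_imgP.
  by case=> /memv_imgP[u _ ->] ve; exists (hproj (e (+) odd k) u);
    rewrite ?hproj_mem // -hproj_pow hproj_id.
by case=> u ue ->; rewrite memv_img ?memvf // grade_pow.
Qed.

Lemma graded_rank0 : nilpotent X ->
  exists N, forall e j, (N <= j)%N -> graded_rank e j = 0%N.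
Proof.
case=> N XN0; exists N => e j /subnK <-; rewrite /graded_rank.
apply/eqP; rewrite dimv_eq0 -lkerE; apply/subvP => v _.
by rewrite memv_ker lfun_powD XN0 zero_lfunE linear0.
Qed.

Lemma rank_diagram_of : nilpotent X -> rank_diagram graded_rank (diagram_of Vg X).
Proof.
move=> nilX; split=> [e|e k]; last by rewrite lines_ge_diagram_of ?ker_im_dimE.
rewrite mset_seqE; apply/count_memPn/negP => /flattenP[s].
case/allpairsPdep=> b [k []]; rewrite mem_iota => _ /andP[k1 _] ->.
by rewrite mem_nseq xpair_eqE => /andP[_ /andP[_ /eqP k0]]; rewrite -k0 in k1.
Qed.

End Graded.

(** * Parity constraints on orthosymplectic ranks *)

Section OspEnd.
Variables (K : fieldType) (V : vectType K) (Vg : bool -> {vspace V}).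
Variables (B : {biscalar V}) (m r : nat) (X : 'End(V)).
Hypothesis hV : osp_space Vg B m r.

Let direct := osp_direct hV.
Let full := osp_full hV.

Lemma osp_orth_hom e x y : x \in Vg e -> y \in Vg (~~ e) -> B x y = 0.
Proof.
by case: e => xe ye; [case: (osp_orth hV ye xe)|case: (osp_orth hV xe ye)].
Qed.

Lemma form_homl e x y : x \in Vg e -> B x y = B x (hproj Vg e y).
Proof.
move=> xe; rewrite -{1}(hproj_add direct full e y) linearDr /=.
by rewrite (osp_orth_hom xe (hproj_mem _ _ _)) addr0.
Qed.

Lemma form_homr e x y : y \in Vg e -> B x y = B (hproj Vg e x) y.
Proof.
move=> ye; rewrite -{1}(hproj_add direct full e x) linearDl /=.
by rewrite (osp_orth_hom (hproj_mem Vg (~~ e) x)) ?negbK ?addr0.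
Qed.

Lemma form_sym e x y : x \in Vg e -> B x y = (-1) ^+ e * B y x.
Proof.
move=> xe; rewrite (form_homl _ xe) (form_homr _ xe).
have := hproj_mem Vg e y; move: (hproj Vg e y) => z.
case: e xe => /= xe ze; rewrite (expr0, expr1) (mul1r, mulN1r).
  have := osp_alt hV (memvD xe ze).
  rewrite linearDl /= !linearDr /= !(osp_alt hV) // addr0 add0r => /eqP.
  by rewrite addr_eq0 => /eqP.
exact: (osp_sym hV xe ze).
Qed.

Lemma osp_nondegenerate x : (forall y, B x y = 0) -> x = 0.
Proof.
move=> x0; rewrite -(hproj_add direct full false x).
have hx0 e : hproj Vg e x = 0.
  apply: (osp_nondeg hV (hproj_mem Vg e x)) => y ye.
  by rewrite -form_homr ?x0.
by rewrite !hx0 addr0.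
Qed.

Lemma orth_hom e : orth B (Vg (~~ e)) = Vg e.
Proof.
apply/vspaceP => v; apply/orthP/idP => [vo|ve w we]; last exact: osp_orth_hom ve we.
rewrite -(hproj_add direct full e v) (_ : hproj Vg (~~ e) v = 0) ?addr0 ?hproj_mem
  //.
apply: (osp_nondeg hV (hproj_mem _ _ _)) => y ye.
by rewrite -form_homr // vo.
Qed.

Lemma orth_add S T : orth B (S + T) = (orth B S :&: orth B T)%VS.
Proof.
apply/vspaceP => v; rewrite memv_cap; apply/orthP/andP => [vo|[/orthP vS /orthP vT]
  w].
  by split; apply/orthP => w ?; apply: vo;
    [apply: (subvP (addvSl S T))|apply: (subvP (addvSr S T))].
by case/memv_addP=> a aS [b bT ->]; rewrite linearDr /= vS // vT // addr0.
Qed.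

(** The subspace is the orthogonal of the direct sum of S and V_(e+1). *)
Lemma dim_orth_hom e S : (S <= Vg e)%VS ->
  \dim (orth B S :&: Vg e) = (\dim (Vg e) - \dim S)%N.
Proof.
move=> Se; rewrite -(orth_hom e) -orth_add (dim_orth osp_nondegenerate).
rewrite dimv_disjoint_sum; last first.
  by apply/eqP; rewrite -subv0 -(hdirect direct e) capvS.
by rewrite orth_hom -(hdim direct full); case: e {Se} => /=; lia.
Qed.

Hypothesis hX : osp_odd Vg B X.
Let grade := osp_odd_grade hX.

(** For x in V_1 this is the definition of u^*; for x in V_0 the alternating form on V_1 contributes
    a sign. *)
Lemma form_adj e x y : x \in Vg e -> B (X x) y = (-1) ^+ (~~ e) * B x (X y).
Proof.
move=> xe; have Xe := grade_mem grade xe.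
rewrite (form_homl _ Xe) (form_homl (X y) xe) (hproj_grade direct full grade).
have := hproj_mem Vg (~~ e) y; move: (hproj Vg (~~ e) y) => z {y}.
case: e xe Xe => /= xe Xe ze; rewrite (expr0, expr1) (mul1r, mulN1r).
  exact: (osp_odd_adj hX ze xe).
rewrite (form_sym _ xe) expr0 mul1r (osp_odd_adj hX xe ze).
by rewrite (form_sym _ Xe) expr1 mulN1r.
Qed.

Lemma form_adj_pow e j :
  exists2 s : K, s != 0 & forall x y, x \in Vg e ->
    B (lfun_pow X j x) y = s * B x (lfun_pow X j y).
Proof.
elim: j e => [|j IHj] e.
  by exists 1 => [|x y _]; rewrite ?oner_neq0 // [lfun_pow X 0]/= !id_lfunE mul1r.
have [s s0 sE] := IHj (~~ e); exists (s * (-1) ^+ (~~ e)) => [|x y xe].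
  by rewrite mulf_neq0 // signr_eq0.
by rewrite lfun_powSr sE ?(grade_mem grade) // (form_adj _ xe) lfun_powS mulrA.
Qed.

(** X acts once from each degree, so exactly one of the two signs is -1 and a single sign is valid
    on all of V. *)
Lemma form_adj2 x y : B (X (X x)) y = - B x (X (X y)).
Proof.
rewrite -(hproj_add direct full false x).
have H e z : z \in Vg e -> B (X (X z)) y = - B z (X (X y)).
  move=> ze; rewrite (form_adj _ (grade_mem grade ze)) (form_adj _ ze) mulrA.
  by case: e ze => /= _; rewrite expr0 expr1 ?mul1r ?mulr1 mulN1r.
by rewrite !linearD !linearDl !(H _ _ (hproj_mem _ _ _)) opprD.
Qed.

Lemma form_adj_even k x y :
  B (lfun_pow X (k.*2) x) y = (-1) ^+ k * B x (lfun_pow X (k.*2) y).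
Proof.
elim: k x y => [|k IHk] x y; first by rewrite [lfun_pow X _]/= !id_lfunE mul1r.
rewrite doubleS !lfun_powS form_adj2 IHk exprS mulN1r mulNr.
by congr (- (_ * B _ _)); rewrite -!lfun_powS -!lfun_powSr.
Qed.

(** One inclusion is adjointness, and the dimensions agree. It gives a test: w lies in Im X^j
    exactly when w is orthogonal to ker X^j. *)
Lemma orth_lker_pow j : orth B (lker (lfun_pow X j)) = limg (lfun_pow X j).
Proof.
apply/esym/eqP; rewrite eqEdim (dim_orth osp_nondegenerate); apply/andP; split.
  apply/subvP => _ /memv_imgP[v _ ->]; apply/orthP => w;
    rewrite memv_ker => /eqP w0.
  rewrite -(hproj_add direct full false v) !linearD linearDl /=.
  have H e : B (lfun_pow X j (hproj Vg e v)) w = 0.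
    have [s _ ->] := form_adj_pow e j; last exact: hproj_mem.
    by rewrite w0 linear0r mulr0.
  by rewrite !H addr0.
by have := limg_ker_dim (lfun_pow X j) fullv; rewrite capfv => <-; rewrite addKn.
Qed.

Lemma graded_rank_limg e j : (limg (lfun_pow X j) :&: Vg e = lfun_pow X j @: Vg (e
  (+) odd j))%VS.
Proof.
apply/vspaceP => v; rewrite memv_cap; apply/andP/memv_imgP.
  by case=> /memv_imgP[u _ ->] ve; exists (hproj Vg (e (+) odd j) u);
    rewrite ?hproj_mem // -(hproj_pow direct full grade) (hproj_id direct).
by case=> u ue ->; rewrite memv_img ?memvf // (grade_pow grade).
Qed.

(** For odd j the maps X^j from V_0 to V_1 and from V_1 to V_0 are adjoint up to sign, hence of
    equal rank. *)
Lemma graded_rank_odd j : odd j -> graded_rank Vg X false j = graded_rank Vg X true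
  j.
Proof.
move=> oj.
have E e : (graded_rank Vg X (~~ e) j + \dim (Vg e :&: lker (lfun_pow X j)) = \dim
  (Vg e))%N.
  by rewrite /graded_rank oj addbT negbK addnC limg_ker_dim.
have E2 e : (graded_rank Vg X e j = \dim (Vg e) - \dim (Vg e :&: lker (lfun_pow X
  j)))%N.
  rewrite -dim_orth_hom ?capvSl // /graded_rank -graded_rank_limg -orth_lker_pow.
  congr (\dim _); apply/vspaceP => v; rewrite !memv_cap; case ve: (v \in Vg e);
    rewrite ?andbF ?andbT //.
  apply/orthP/orthP => vo w; first by rewrite memv_cap => /andP[_]; apply: vo.
  move=> wk; rewrite (form_homl _ ve); apply: vo.
  rewrite memv_cap hproj_mem memv_ker.
  have := hproj_pow direct full grade (e (+) odd j) j w; rewrite addbK => <-.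
  by move: wk; rewrite memv_ker => /eqP ->; rewrite linear0 eqxx.
have := E false; have := E2 false; have := E2 true; have := E true => /=; lia.
Qed.

Hypothesis K2 : 2%:R != 0 :> K.

(* The form B(x, X^j y) is alternating on V_e. *)
Lemma graded_rank_alt e j : (j %% 4)%N = (if e then 0 else 2)%N -> ~~ odd
  (graded_rank Vg X e j).
Proof.
move=> j4; pose k := j./2; have jE : j = k.*2 by rewrite /k; case: e j4; lia.
(* Composing with the projection extends the form on V_e to a skew-symmetric form on V. *)
have -> : graded_rank Vg X e j = \dim (limg (lfun_pow X j \o hproj Vg e)).
  by rewrite limg_comp hproj_limg // /graded_rank jE odd_double addbF.
apply: (even_dim_limg_alt osp_nondegenerate K2) => x y.
have pe z : lfun_pow X j (hproj Vg e z) \in Vg e.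
  have := grade_pow grade (e:=e) (j:=j) (v:=hproj Vg e z).
  by rewrite {1}jE odd_double addbF => /(_ (hproj_mem _ _ _)).
rewrite !comp_lfunE (form_homr x (pe y)) (form_homr y (pe x)).
rewrite (form_sym _ (hproj_mem Vg e x)) jE form_adj_even mulrA.
(* With j = 2k, the residue of j modulo 4 makes e + k odd. *)
rewrite (_ : (-1) ^+ e * (-1) ^+ k = -1 :> K) ?mulN1r // -(signr_odd K k)
  -signr_addb.
by have -> : e (+) odd k = true by rewrite /k; case: e j4 {pe}; lia.
Qed.

Lemma admissible_diagram_of : nilpotent X -> admissible (diagram_of Vg X).
Proof.
move=> nilX; apply: (admissible_ranks (rank_diagram_of direct full grade nilX)).
- exact: graded_rank_odd.
- by move=> j j2; apply: graded_rank_alt.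
- by move=> j j0; apply: graded_rank_alt.
Qed.

End OspEnd.

(** * Reduction by an isotropic line *)

Section LineReduction.
Variables (K : fieldType) (V : vectType K) (Vg : bool -> {vspace V}).
Variables (B : {biscalar V}) (m r : nat) (X : 'End(V)).
Hypotheses (hV : osp_space Vg B m r) (hX : osp_odd Vg B X).

Let direct := osp_direct hV.
Let full := osp_full hV.
Let grade := osp_odd_grade hX.

Variables (e : bool) (w : V).
Hypotheses (we : w \in Vg e) (w0 : w != 0) (Xw : X w = 0).
Local Notation H := (orth B <[w]>).

Lemma mem_orth_line x : (x \in H) = (B x w == 0).
Proof.
apply/orthP/eqP => [->|xw _ /vlineP[a ->]]; rewrite ?memv_line //.
by rewrite linearZr /= xw mulr0.
Qed.

Lemma form_line_img x : B (X x) w = 0.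
Proof.
have Bw y : B y w = 0 <-> B w y = 0.
  by rewrite (form_sym hV y we); case: (e);
    rewrite (expr0, expr1) (mul1r, mulN1r) //;
    split=> [->|/eqP]; rewrite ?oppr0 ?oppr_eq0 // => /eqP.
apply/Bw; have := form_adj hV hX x we; rewrite Xw linear0l.
by move=> /esym/eqP; rewrite mulf_eq0 signr_eq0 => /eqP.
Qed.

Lemma orth_line_other e' : e' != e -> (Vg e' <= H)%VS.
Proof.
move=> ne; apply/subvP => x xe; rewrite mem_orth_line (form_homr hV _ we).
by rewrite (hproj0 direct full (e := e)) ?linear0l //;
  case: (e) (e') ne xe => [] [].
Qed.

Lemma pow_orth_line j x : x \in H -> lfun_pow X j x \in H.
Proof.
case: j => [|j]; first by rewrite [lfun_pow X _]/= id_lfunE.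
by rewrite lfun_powS => _; rewrite mem_orth_line form_line_img.
Qed.

Variable k : nat.
Hypothesis kP : forall j, (w \in limg (lfun_pow X j)) = (j < k)%N.

(** For j < k, w is orthogonal to ker X^j, so passing to w^\perp keeps the kernel on V_e and lowers
    the image by one; for j >= k it lowers the kernel instead. Only the degree e of the source is
    affected. *)
Lemma dim_pow_orth_line e' j :
  (\dim (lfun_pow X j @: (H :&: Vg (e' (+) odd j))) + ((j < k) && (e' (+) odd j ==
    e))
   = graded_rank Vg X e' j)%N.
Proof.
rewrite /graded_rank; move: (e' (+) odd j) => a.
have [->|ne] := eqVneq a e; last first.
  by rewrite andbF addn0; congr (\dim (_ @: _)); apply/capv_idPr/orth_line_other.
rewrite andbT; set f := lfun_pow X j.
have dH : (\dim (H :&: Vg e) = \dim (Vg e) - 1)%N.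
  by rewrite (dim_orth_hom hV) -?memvE // dim_vline w0.
have V0 : (0 < \dim (Vg e))%N.
  by have := dimvS (_ : <[w]> <= Vg e)%VS; rewrite dim_vline w0 -memvE; apply.
have := limg_ker_dim f (H :&: Vg e)%VS; have := limg_ker_dim f (Vg e).
have sub : (H :&: Vg e :&: lker f <= Vg e :&: lker f)%VS by rewrite capvS ?capvSr.
have sub2 : (f @: (H :&: Vg e) <= f @: Vg e)%VS by rewrite limgS ?capvSr.
have := kP j; rewrite -/f -(orth_lker_pow hV hX) -/f.
have [jk wo|kj wo] := ltnP j k.
  have -> : (H :&: Vg e :&: lker f = Vg e :&: lker f)%VS.
    apply/eqP; rewrite eqEsubv sub /= subv_cap capvSr andbT subv_cap capvSl andbT.
    apply/subvP => x; rewrite memv_cap mem_orth_line => /andP[xe xk].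
    by rewrite (form_sym hV _ xe) (elimT (orthP _ _ _) wo x xk) mulr0 eqxx.
  by move: dH; lia.
have : ~~ (Vg e :&: lker f <= H :&: Vg e :&: lker f)%VS.
  apply: contraFN wo => sub3; apply/orthP => z zk.
  rewrite (form_homl hV _ we).
  have zke : hproj Vg e z \in (Vg e :&: lker f)%VS.
    rewrite memv_cap hproj_mem memv_ker.
    have := hproj_pow direct full grade (e (+) odd j) j z; rewrite addbK -/f => <-.
    by move: zk; rewrite memv_ker => /eqP ->; rewrite linear0 eqxx.
  have := subvP sub3 _ zke; rewrite !memv_cap mem_orth_line => /andP[/andP[/eqP zw
    _] _].
  by rewrite (form_sym hV _ we) zw mulr0.
move=> nsub; have : (\dim (H :&: Vg e :&: lker f) < \dim (Vg e :&: lker f))%N.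
  by rewrite ltnNge; apply: contra nsub => le;
    have := eqEdim (H :&: Vg e :&: lker f) (Vg e :&: lker f);
   rewrite sub le => /eqP ->.
by have := dimvS sub2; rewrite dH; lia.
Qed.

(** If j + 1 < k, then w = X^j (X v) with X v in w^\perp; if j is odd, homogeneous preimages of w
    have the other degree and lie in w^\perp. The only doubtful case is j = k - 1 with j even. *)
Lemma mem_pow_orth_line (e' : bool) j : let S := (lfun_pow X j @: (H :&: Vg (e' (+)
  odd j)))%VS in
  (w \in S) = (j < k)%N && (e' == e) && ~~ ((j == k.-1) && odd k && (w \notin
    (lfun_pow X k.-1 @: (H :&: Vg e))%VS)).
Proof.
have [jk|kj] := ltnP j k => /=; last first.
  apply: contraTF kj => /memv_imgP[x _ wx];
    rewrite -ltnNge -kP wx memv_img ?memvf //.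
have [->|ne] /= := eqVneq e' e; last first.
  apply: contraNF w0 => /memv_imgP[x]; rewrite memv_cap => /andP[_ xe] wx.
  have : w \in (Vg e :&: Vg (~~ e))%VS.
    rewrite memv_cap we; have := grade_pow grade xe; rewrite -wx.
    by case: (e) (e') ne => [] [].
  by rewrite (hdirect direct) memv0.
have wT i : (i < k)%N -> w \in (lfun_pow X i @: Vg (e (+) odd i))%VS.
  by rewrite -kP -(graded_rank_limg hV hX) memv_cap we andbT.
have [oj|ej] := boolP (odd j).
  have := wT _ jk; rewrite ?oj addbT.
  have /capv_idPr -> : (Vg (~~ e) <= H)%VS by apply: orth_line_other; case: (e).
  move=> ->; case: eqP => //= jk1.
  by have -> : odd k = false by lia.
rewrite addbF; have [jk1|jk1] := eqVneq j k.-1.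
  have -> : odd k = true by lia.
  by rewrite jk1 negbK.
have jk2 : (j.+1 < k)%N by lia.
have /memv_imgP[v ve wv] := wT _ jk2.
have XvH : X v \in (H :&: Vg e)%VS.
  rewrite memv_cap mem_orth_line form_line_img eqxx /=.
  by have := grade_mem grade ve; rewrite /= ej addbT negbK.
by rewrite {1}wv lfun_powSr memv_img.
Qed.

End LineReduction.

(** Here [p], [q], [t], [c] stand for j < k, j = k - 1, e' = e and the exceptional case, and [s] for
    the loss at the source. Since [q] implies [p], the subtraction does not truncate. *)
Lemma drop_arith (p q t c : bool) (d s : nat) : (q -> p) ->
  (d + (p && t + s - c && t && q) = p && t && ~~ (q && c) + d + s)%N.
Proof.
case: p => [_|qp]; last by case: q qp => [/(_ isT)|_] //=;
  rewrite andbF subn0 addnA addn0.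
by case: q; case: t; case: c => /=; lia.
Qed.

(* [V2] is any model of w^\perp / <w>: this avoids identifying an iterated
   quotient with a quotient of the ambient space. *)
Lemma line_reduction (K : fieldType) (V V2 : vectType K) (Vg : bool -> {vspace V})
    (B : {biscalar V}) (m r : nat) (X : 'End(V))
    (Vg2 : bool -> {vspace V2}) (X2 : 'End(V2)) (pi : 'Hom(V, V2))
    (e : bool) (w : V) :
  osp_space Vg B m r -> osp_odd Vg B X -> nilpotent X ->
  w \in Vg e -> w != 0 -> X w = 0 -> B w w = 0 ->
  {in orth B <[w]>, forall x, pi (X x) = X2 (pi x)} ->
  {in orth B <[w]>, forall x, (pi x == 0) = (x \in <[w]>%VS)} ->
  (forall e', pi @: (orth B <[w]> :&: Vg e') = Vg2 e')%VS ->
  exists k (b : bool), [/\ (0 < k)%N, b -> odd k && (1 < k)%N &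
    forall e' j, (graded_rank Vg2 X2 e' j + end_drop e k b e' j = graded_rank Vg X
      e' j)%N].
Proof.
move=> hV hX nilX we w0 Xw ww piX pi0 piV.
have exk : exists j, w \notin limg (lfun_pow X j).
  by case: nilX => N XN; exists N; rewrite XN lim0g memv0.
(* The least k with w outside Im X^k is the length of the lines that lose a box. *)
case: (ex_minnP exk) => k wk kmin.
have kP j : (w \in limg (lfun_pow X j)) = (j < k)%N.
  have [jk|kj] := ltnP j k.
    by apply: contraTT jk => /kmin; rewrite -leqNgt.
  by apply: contraNF wk; apply: (subvP (limg_lfun_pow_leq X kj)).
have k0 : (0 < k)%N by rewrite -kP [lfun_pow X 0]/= lim1g memvf.
set H := orth B <[w]> in piX pi0 piV *.
pose b := odd k && (w \notin (lfun_pow X k.-1 @: (H :&: Vg e))%VS).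
exists k, b; split=> // [/andP[ok wn]|e' j].
  (* For k = 1 the power X^(k-1) is the identity, and w lies in w^\perp since it is isotropic; so
     [b] forces k > 1. *)
  rewrite ok /= ltn_neqAle k0 andbT; apply: contraNneq wn => <-.
  by rewrite [lfun_pow X _]/= lim1g memv_cap we (mem_orth_line B) ww eqxx.
rewrite -(dim_pow_orth_line hV hX we w0 kP) /end_drop -/H.
set S := (lfun_pow X j @: (H :&: Vg (e' (+) odd j)))%VS.
have wS := mem_pow_orth_line hV hX we w0 Xw kP e' j; rewrite /= -/H -/S in wS.
have SH : (S <= H)%VS.
  apply/subvP => _ /memv_imgP[x + ->]; rewrite memv_cap => /andP[xH _].
  exact: (pow_orth_line hV hX we Xw).
have piXj i x : x \in H -> pi (lfun_pow X i x) = lfun_pow X2 i (pi x).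
  move=> xH; elim: i => [|i IHi]; first by rewrite [lfun_pow X _]/= [lfun_pow X2
    _]/= !id_lfunE.
  by rewrite !lfun_powS -IHi piX //; apply: (pow_orth_line hV hX we Xw).
have -> : graded_rank Vg2 X2 e' j = \dim (pi @: S).
  rewrite /graded_rank -piV /S -!limg_comp; congr (\dim _).
  apply: eq_in_limg => x; rewrite memv_cap => /andP[xH _].
  by rewrite !comp_lfunE piXj.
have <- := limg_ker_dim pi S.
(* Dividing by w lowers the dimension of [S] by one exactly when w lies in [S]. *)
have -> : \dim (S :&: lker pi) = (w \in S).
  have -> : (S :&: lker pi = S :&: <[w]>)%VS.
    apply/vspaceP => x; rewrite !memv_cap memv_ker; have [xS|//] := boolP (x \in S).
    by rewrite pi0 //; apply: (subvP SH).
  case wS' : (w \in S).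
    have /capv_idPr -> : (<[w]> <= S)%VS by rewrite -memvE.
    by rewrite dim_vline w0.
  apply/eqP; rewrite dimv_eq0 -subv0; apply/subvP => x;
    rewrite memv_cap => /andP[xS /vlineP[a xa]].
  rewrite memv0 xa scaler_eq0; apply/orP; left; apply: contraFT wS' => a0.
  by rewrite -[w](scalerK a0) -xa memvZ.
rewrite wS -[_ && (w \notin _)]andbA -/b drop_arith // => /eqP ->.
by rewrite prednK.
Qed.

(** * Orthosymplectic reduction *)

(** The form is evaluated on representatives in the chosen complement; [quot_formE] identifies it
    with the form induced by [B]. *)
Definition quot_form (K : fieldType) (V : vectType K) (B : {biscalar V})
  (U W : {vspace V}) (a b : quot U W) : K := B (vsval a) (vsval b).

Lemma quot_form_bilinear (K : fieldType) (V : vectType K) (B : {biscalar V}) (U W :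
  {vspace V}) :
  bilinear_for ( *%R : K -> K -> K) *%R (@quot_form K V B U W).
Proof.
split=> z a x y; rewrite /quot_form [vsval (_ + _)]linearP.
  exact: linearPl.
exact: linearPr.
Qed.

HB.instance Definition _ (K : fieldType) (V : vectType K) (B : {biscalar V}) (U W :
  {vspace V}) :=
  bilinear_isBilinear.Build K (quot U W) (quot U W) K _ _ (@quot_form K V B U W)
    (@quot_form_bilinear K V B U W).


Section OspQuotient.
Variables (K : fieldType) (V : vectType K) (Vg : bool -> {vspace V}).
Variables (B : {biscalar V}) (m r : nat) (X : 'End(V)).
Hypotheses (hV : osp_space Vg B m r) (hX : osp_odd Vg B X).

Let direct := osp_direct hV.
Let full := osp_full hV.
Let grade := osp_odd_grade hX.

(* The conditions under which W^\perp / W inherits an orthosymplectic structure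
   and an odd endomorphism from V. *)
Record reducible (W : {vspace V}) : Prop := Reducible {
  red_graded : forall e v, v \in W -> hproj Vg e v \in W;
  red_isotropic : (W <= orth B W)%VS;
  red_stable : (X @: W <= W)%VS }.

Section OneSubspace.
Variable W : {vspace V}.
Hypothesis hW : reducible W.
Local Notation U := (orth B W).
Local Notation q := (quot_proj U W).
Local Notation Vq := (quot_grading U W Vg).
Local Notation Xq := (quot_end U W X).
Local Notation Bq := (@quot_form K V B U W : {biscalar (quot U W)}).

Let WU := red_isotropic hW.

(** [orth] is a left orthogonal, and [B] has different symmetries on V_0 and V_1. Splitting w into
    homogeneous parts, which stay in [W], allows the arguments to be swapped. *)
Lemma form_orth_sym x w : x \in U -> w \in W -> B w x = 0.
Proof.
move=> /orthP xU wW; rewrite -(hproj_add direct full false w) linearDl /=.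
have H e : B (hproj Vg e w) x = 0.
  by rewrite (form_sym hV _ (hproj_mem _ _ _)) xU ?mulr0 // (red_graded hW).
by rewrite !H addr0.
Qed.

Lemma orth_graded e x : x \in U -> hproj Vg e x \in U.
Proof.
move=> /orthP xU; apply/orthP => w wW.
rewrite (form_homl hV _ (hproj_mem _ _ _)) -(form_homr hV _ (hproj_mem _ _ _)).
by rewrite xU // (red_graded hW).
Qed.

Lemma orth_stable : (X @: U <= U)%VS.
Proof.
apply/subvP => _ /memv_imgP[x xU ->]; apply/orthP => w wW.
rewrite -(hproj_add direct full false x) linearD linearDl /=.
have H e : B (X (hproj Vg e x)) w = 0.
  rewrite (form_adj hV hX _ (hproj_mem _ _ _)).
  have /orthP -> := orth_graded e xU; first by rewrite mulr0.
  by apply: (subvP (red_stable hW)); apply: memv_img.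
by rewrite !H addr0.
Qed.

Lemma orth_stable_pow j x : x \in U -> lfun_pow X j x \in U.
Proof.
move=> xU; elim: j => [|j IHj]; first by rewrite [lfun_pow X _]/= id_lfunE.
by rewrite lfun_powS; apply: (subvP orth_stable); apply: memv_img.
Qed.

Lemma orth_orth : orth B U = W.
Proof.
apply/esym/eqP; rewrite eqEdim !(dim_orth (osp_nondegenerate hV)); apply/andP;
  split.
  by apply/subvP => w wW; apply/orthP => x xU; apply: form_orth_sym.
by rewrite subKn // dimvS // subvf.
Qed.

Lemma quot_projP z : exists2 v, v \in U & q v = z.
Proof. exact: quot_proj_surj. Qed.

Lemma quot_proj_mem0 v : v \in U -> (q v == 0) = (v \in W).
Proof. exact: quot_proj_eq0. Qed.

Lemma quot_proj_val v : v \in U -> vsval (q v) - v \in W.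
Proof.
move=> vU; rewrite quot_projE; have UW : v \in (U + W)%VS by rewrite (addv_idPl WU).
by rewrite -{2}(addv_pi1_pi2 UW) opprD addrA subrr add0r memvN memv_pi2.
Qed.

Lemma quot_formE x y : x \in U -> y \in U -> Bq (q x) (q y) = B x y.
Proof.
move=> xU yU; rewrite -[LHS]/(B (vsval (q x)) (vsval (q y))).
have := quot_proj_val xU; have := quot_proj_val yU.
rewrite -[vsval (q x)](subrK x) -[vsval (q y)](subrK y) !addrK.
move: (vsval (q x) - x) (vsval (q y) - y) => a b bW aW.
rewrite linearDl !linearDr /= (form_orth_sym yU aW) (elimT (orthP _ _ _) xU _ bW).
by rewrite (elimT (orthP _ _ _) (subvP WU _ aW) _ bW) !add0r.
Qed.

Lemma quot_end_pow j v : v \in U -> lfun_pow Xq j (q v) = q (lfun_pow X j v).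
Proof.
move=> vU; elim: j => [|j IHj].
  by rewrite [lfun_pow X _]/= [lfun_pow Xq _]/= !id_lfunE.
rewrite !lfun_powS IHj quot_endE //; [exact: orth_stable | exact: red_stable hW|].
exact: orth_stable_pow.
Qed.

Lemma quot_gradingP e z : reflect (exists2 v, v \in (U :&: Vg e)%VS & z = q v) (z
  \in Vq e).
Proof. exact: memv_imgP. Qed.

(** The dimension drops by dim (W \cap V_e) on passing to W^\perp, and again on dividing by W. *)
Lemma quot_grading_dim e : (\dim (Vq e) + 2 * \dim (W :&: Vg e) = \dim (Vg e))%N.
Proof.
have hd : (\dim (U :&: Vg e) + \dim (W :&: Vg e) = \dim (Vg e))%N.
  have <- : (orth B (W :&: Vg e) :&: Vg e = U :&: Vg e)%VS.
    apply/vspaceP => v; rewrite !memv_cap; case ve: (v \in Vg e);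
      rewrite ?andbF ?andbT //.
    apply/orthP/orthP => vo w; last by rewrite memv_cap => /andP[wW _]; apply: vo.
    by move=> wW; rewrite (form_homl hV _ ve) vo // memv_cap (red_graded hW)
      ?hproj_mem.
  by rewrite (dim_orth_hom hV) ?capvSr // subnK ?dimvS ?capvSr.
have := limg_ker_dim q (U :&: Vg e)%VS.
have -> : (U :&: Vg e :&: lker q = W :&: Vg e)%VS.
  apply/vspaceP => v; rewrite !memv_cap memv_ker.
  apply/andP/andP => [[/andP[vU ve]]|[vW ve]]; first by rewrite quot_proj_mem0.
  by rewrite quot_proj_mem0 (subvP WU) ?ve.
by rewrite /quot_grading; lia.
Qed.

Lemma osp_quot m' r' :
  (m' + 2 * \dim (W :&: Vg false) = m)%N -> (r' + \dim (W :&: Vg true) = r)%N ->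
  osp_space Vq Bq m' r'.
Proof.
move=> mE rE; split.
- apply/eqP; rewrite -subv0; apply/subvP => z; rewrite memv_cap memv0.
  case/andP=> /quot_gradingP[a]; rewrite memv_cap => /andP[aU ae] ->
    /quot_gradingP[b].
  rewrite memv_cap => /andP[bU be] /eqP; rewrite -subr_eq0 -linearB.
  rewrite quot_proj_mem0 => [abW|]; last exact: memvB.
  have := red_graded hW false abW.
  rewrite linearB /= (hproj_id direct ae) (hproj0 direct full) ?subr0 //.
  by move=> aW; rewrite quot_proj_mem0.
- apply/vspaceP => z; rewrite memvf; have [v vU <-] := quot_projP z.
  rewrite -(hproj_add direct full false v) linearD memv_add //; apply/quot_gradingP.
    by exists (hproj Vg false v); rewrite // memv_cap orth_graded ?hproj_mem.
  by exists (hproj Vg true v); rewrite // memv_cap orth_graded ?hproj_mem.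
- by have := quot_grading_dim false; rewrite (osp_dim0 hV); lia.
- by have := quot_grading_dim true; rewrite (osp_dim1 hV); lia.
- move=> x y /quot_gradingP[a]; rewrite memv_cap => /andP[aU ae] ->
    /quot_gradingP[b].
  rewrite memv_cap => /andP[bU be] ->; rewrite !quot_formE //.
  exact: (osp_orth hV ae be).
- move=> x y /quot_gradingP[a]; rewrite memv_cap => /andP[aU ae] ->
    /quot_gradingP[b].
  rewrite memv_cap => /andP[bU be] ->; rewrite !quot_formE //.
  exact: (osp_sym hV ae be).
- move=> x /quot_gradingP[a]; rewrite memv_cap => /andP[aU ae] ->.
  by rewrite quot_formE //; apply: (osp_alt hV ae).
- move=> e x /quot_gradingP[a]; rewrite memv_cap => /andP[aU ae] -> H.
  (* Nondegeneracy: a vector orthogonal to W^\perp lies in [W], hence has class zero. *)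
  apply/eqP; rewrite quot_proj_mem0 // -orth_orth; apply/orthP => y yU.
  rewrite (form_homl hV _ ae) -quot_formE ?orth_graded // H //.
  by apply/quot_gradingP; exists (hproj Vg e y);
    rewrite // memv_cap orth_graded ?hproj_mem.
Qed.

Lemma osp_odd_quot : osp_odd Vq Bq Xq.
Proof.
have Xq_q v : v \in U -> Xq (q v) = q (X v).
  by move=> vU; rewrite quot_endE //; [exact: orth_stable | exact: red_stable hW].
have XU v : v \in U -> X v \in U.
  by move=> vU; apply: (subvP orth_stable); apply: memv_img.
split.
- move=> e; apply/subvP => _ /memv_imgP[_ /quot_gradingP[v + ->] ->].
  rewrite memv_cap => /andP[vU ve]; rewrite Xq_q //; apply/quot_gradingP.
  by exists (X v); rewrite // memv_cap XU // (grade_mem grade).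
- move=> x y /quot_gradingP[a]; rewrite memv_cap => /andP[aU ae] ->
    /quot_gradingP[b].
  rewrite memv_cap => /andP[bU be] ->; rewrite !Xq_q // !quot_formE ?XU //.
  exact: (osp_odd_adj hX ae be).
Qed.

Lemma nilpotent_quot : nilpotent X -> nilpotent Xq.
Proof.
case=> N XN0; exists N; apply/lfunP => z; have [v vU <-] := quot_projP z.
by rewrite quot_end_pow // XN0 !zero_lfunE linear0.
Qed.

(** A rank on the quotient is expressed through subspaces of V, by dim q(S) = dim (S + W) - dim
    W. *)
Lemma graded_rank_quot e j :
  (graded_rank Vq Xq e j + \dim W
    = \dim (lfun_pow X j @: (U :&: Vg (e (+) odd j)) + W)%VS)%N.
Proof.
rewrite /graded_rank /quot_grading; move: (U :&: Vg _)%VS (capvSl U (Vg (e (+) odd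
  j))) => T TU.
have -> : (lfun_pow Xq j @: (q @: T) = q @: (lfun_pow X j @: T))%VS.
  rewrite -!limg_comp; apply: eq_in_limg => x xT.
  by rewrite [LHS]comp_lfunE [RHS]comp_lfunE quot_end_pow // (subvP TU).
set S := (lfun_pow X j @: T)%VS.
have := limg_ker_dim q S; have := dimv_sum_cap S W.
have -> : (S :&: lker q = S :&: W)%VS.
  apply/vspaceP => v; rewrite !memv_cap memv_ker; have [vS|//] := boolP (v \in S).
  rewrite quot_proj_mem0 //; case/memv_imgP: vS => x xT ->.
  by apply: orth_stable_pow; apply: (subvP TU).
by lia.
Qed.

End OneSubspace.
End OspQuotient.

(** * Diagrams on successive quotients *)

Section Induced.
Variables (K : fieldType) (V : vectType K) (Vg : bool -> {vspace V}).
Variables (B : {biscalar V}) (m r : nat) (X : 'End(V)).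
Hypotheses (hV : osp_space Vg B m r) (hX : osp_odd Vg B X) (nilX : nilpotent X).

Let direct := osp_direct hV.
Let full := osp_full hV.
Let grade := osp_odd_grade hX.

Lemma osp_induced W : reducible Vg B X W ->
  osp_space (quot_grading (orth B W) W Vg) (@quot_form K V B (orth B W) W)
    (m - 2 * \dim (W :&: Vg false)) (r - \dim (W :&: Vg true)).
Proof.
move=> hW; apply: (osp_quot hV hW).
  by have := quot_grading_dim hV hW false; rewrite (osp_dim0 hV); lia.
by have := quot_grading_dim hV hW true; rewrite (osp_dim1 hV); lia.
Qed.

Lemma rank_diagram_induced W : reducible Vg B X W ->
  rank_diagram (graded_rank (quot_grading (orth B W) W Vg) (quot_end (orth B W) W
    X))
    (induced_diagram Vg B X W).
Proof.
move=> hW; have hq := osp_induced hW.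
apply: rank_diagram_of; [exact: (osp_direct hq)|exact: (osp_full hq)| |exact:
  (nilpotent_quot hV hX hW nilX)].
exact: (osp_odd_grade (osp_odd_quot hV hX hW)).
Qed.

(** The quotient by 0 is not literally V, so the diagrams are compared through their ranks. *)
Lemma induced_diagram0 : reducible Vg B X 0 /\ induced_diagram Vg B X 0 =
  diagram_of Vg X.
Proof.
have h0 : reducible Vg B X 0.
  split; rewrite ?sub0v ?limg0 ?subvv // => e v; rewrite !memv0 => /eqP ->.
  by rewrite linear0.
split=> //; apply: (rank_diagram_uniq (r := graded_rank Vg X));
  last exact: rank_diagram_of.
have := rank_diagram_induced h0; rewrite /rank_diagram.
have E e j : graded_rank (quot_grading (orth B 0) 0 Vg) (quot_end (orth B 0) 0 X) e
  j = graded_rank Vg X e j.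
  have := graded_rank_quot hV hX h0 e j; rewrite dimv0 addn0 addv0 => ->.
  rewrite /graded_rank; congr (\dim (_ @: _)); apply/capv_idPr/subvP => x _.
  by apply/orthP => w; rewrite memv0 => /eqP ->; rewrite linear0r.
by case=> D0 Dr; split=> // e k; rewrite -!E.
Qed.

Lemma boxes_induced W : reducible Vg B X W -> forall e,
  (boxes e (induced_diagram Vg B X W) + 2 * \dim (W :&: Vg e) = \dim (Vg e))%N.
Proof.
move=> hW e; have [N r0] := graded_rank0 (quot_grading (orth B W) W Vg)
  (nilpotent_quot hV hX hW nilX).
rewrite (boxes_ranks r0 (rank_diagram_induced hW)) -(quot_grading_dim hV hW e).
by rewrite /graded_rank /= addbF lim1g.
Qed.

Lemma admissible_induced W : 2%:R != 0 :> K -> reducible Vg B X W ->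
  admissible (induced_diagram Vg B X W).
Proof.
move=> K2 hW; apply: (admissible_diagram_of (osp_induced hW)) => //.
  exact: (osp_odd_quot hV hX hW).
exact: (nilpotent_quot hV hX hW nilX).
Qed.

(** [line_reduction] is applied to W^\perp / W and the class of w, with W'^\perp / W' as the model
    of the reduced space, where W' = W + <w>. *)
Lemma remove_ends_induced W e w : reducible Vg B X W -> reducible Vg B X (W +
  <[w]>) ->
  w \in Vg e -> w \notin W -> X w \in W ->
  remove_ends (induced_diagram Vg B X W) (induced_diagram Vg B X (W + <[w]>)).
Proof.
move=> hW hW' we wW XwW; set W' := (W + <[w]>)%VS in hW' *.
have WW' : (W <= W')%VS by apply: addvSl.
have wW' : w \in W' by rewrite memvE addvSr.
have w'U : w \in orth B W' by apply: (subvP (red_isotropic hW')).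
have U'U : (orth B W' <= orth B W)%VS.
  apply/subvP => x /orthP xo; apply/orthP => y yW; apply: xo; exact: (subvP WW').
have wU := subvP U'U _ w'U.
pose q := quot_proj (orth B W) W; pose q' := quot_proj (orth B W') W'.
(* The map is defined through representatives and is meaningful on classes of vectors of W'^\perp;
   by [inH] and [Hin] these form the orthogonal of the class of w. *)
pose pi := (q' \o linfun (@vsval _ _ (orth B W :\: W)%VS))%VF.
have piE x : x \in orth B W' -> pi (q x) = q' x.
  move=> xU'; have -> : pi (q x) = q' (vsval (q x)).
    by rewrite [LHS]comp_lfunE; congr (q' _); rewrite lfunE.
  apply/eqP; rewrite -subr_eq0 -linearB; have d := quot_proj_val hW (subvP U'U _
    xU').
  by rewrite (quot_proj_mem0 hW') ?(subvP (red_isotropic hW')) // (subvP WW').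
have inH z : z \in orth (@quot_form K V B (orth B W) W : {biscalar _}) <[q w]> ->
    exists2 x, x \in orth B W' & z = q x.
  have [x xU <-] := quot_projP z; move=> /orthP/(_ _ (memv_line _)).
  rewrite (quot_formE hV hW) // => xw; exists x => //.
  apply/orthP => _ /memv_addP[a aW [_ /vlineP[c ->] ->]].
  by rewrite linearDr linearZr /= xw mulr0 addr0; apply: (elimT (orthP _ _ _) xU).
have Hin x : x \in orth B W' -> q x \in orth (@quot_form K V B (orth B W) W :
  {biscalar _}) <[q w]>.
  move=> xU'; apply/orthP => _ /vlineP[c ->]; rewrite linearZr /=.
  rewrite (quot_formE hV hW) ?(subvP U'U) //.
  by rewrite (elimT (orthP _ _ _) xU') ?mulr0.
have [] := @line_reduction _ _ _ _ _ _ _ _ (quot_grading (orth B W') W' Vg)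
  (quot_end (orth B W') W' X) pi e (q w)
   (osp_induced hW) (osp_odd_quot hV hX hW) (nilpotent_quot hV hX hW nilX).
- by apply/quot_gradingP; exists w; rewrite // memv_cap wU.
- by rewrite (quot_proj_mem0 hW).
- rewrite quot_endE ?(orth_stable hV hX hW) ?(red_stable hW) ?(red_isotropic hW) //.
  apply/eqP; rewrite (quot_proj_mem0 hW) //; exact: (subvP (red_isotropic hW)).
- by rewrite (quot_formE hV hW) // (elimT (orthP _ _ _) w'U).
- move=> _ /inH[x xU' ->].
  have XU' : X x \in orth B W' by apply: (subvP (orth_stable hV hX hW'));
    apply: memv_img.
  rewrite quot_endE ?(orth_stable hV hX hW) ?(red_stable hW) ?(red_isotropic hW)
    ?(subvP U'U) //.
  rewrite !piE // quot_endE ?(orth_stable hV hX hW') ?(red_stable hW')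
    ?(red_isotropic hW') //.
- move=> _ /inH[x xU' ->]; rewrite piE // (quot_proj_mem0 hW') //.
  apply/memv_addP/vlineP => [[a aW [_ /vlineP[c ->] ->]]|[c /eqP]].
    by exists c; rewrite linearD linearZ /= (eqP (_ : q a == 0)) ?add0r //
      (quot_proj_mem0 hW) // (subvP (red_isotropic hW)).
  rewrite -linearZ -subr_eq0 -linearB (quot_proj_mem0 hW); last first.
    by rewrite memvB ?memvZ // (subvP U'U).
  by move=> d; exists (x - c *: w) => //; exists (c *: w);
    rewrite ?memvZ ?memv_line ?subrK.
- move=> e'; apply/vspaceP => z; apply/memv_imgP/quot_gradingP => [[y + ->]|[x +
    ->]].
    rewrite memv_cap => /andP[yH /quot_gradingP[x + yE]];
      rewrite memv_cap => /andP[xU xe].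
    have xU' : x \in orth B W'.
      apply/orthP => _ /memv_addP[a aW [_ /vlineP[c ->] ->]].
      rewrite linearDr linearZr /= (elimT (orthP _ _ _) xU) // add0r.
      by rewrite -(quot_formE hV hW) // -yE (elimT (orthP _ _ _) yH) ?memv_line
        ?mulr0.
    by exists x; rewrite ?memv_cap ?xU' // yE piE.
  rewrite memv_cap => /andP[xU' xe]; exists (q x); rewrite ?piE // memv_cap Hin //=.
  by apply/quot_gradingP; exists x; rewrite // memv_cap (subvP U'U).
move=> k [b [k0 bk rE]].
exact: remove_ends_ranks (rank_diagram_induced hW) (rank_diagram_induced hW') k0 bk
  rE.
Qed.

End Induced.

(** * Closedness of rank conditions *)

(** Project the row space onto the last [p2] coordinates: the image is the row space of [Q], and the
    kernel consists of the u L with u Q = 0. *)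
Lemma mxrank_row_ker (K : fieldType) m p1 p2 (L : 'M[K]_(m, p1)) (Q : 'M[K]_(m,
  p2)) :
  \rank (row_mx L Q) = (\rank Q + \rank (kermx Q *m L))%N.
Proof.
pose E : 'M[K]_(p1 + p2, p2) := col_mx 0 1%:M.
have PE : row_mx L Q *m E = Q by rewrite mul_row_col mulmx0 add0r mulmx1.
rewrite -(mxrank_mul_ker _ E) PE; congr addn.
rewrite -(rank_row_mx0 p2 (kermx Q *m L)).
apply: eqmx_rank; apply/andP; split.
  apply/rV_subP => u; rewrite sub_capmx => /andP[/submxP[v ->] /sub_kermxP].
  rewrite -mulmxA PE => /sub_kermxP/submxP[v' ->].
  have -> : v' *m kermx Q *m row_mx L Q = v' *m row_mx (kermx Q *m L) 0.
    rewrite !mul_mx_row mulmxA -[v' *m kermx Q *m Q]mulmxA.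
    by rewrite mulmx_ker.
  exact: submxMl.
rewrite sub_capmx; apply/andP; split.
  by rewrite -(mulmx_ker Q) -mul_mx_row submxMl.
by apply/sub_kermxP; rewrite mul_row_col mulmx0 mul0mx addr0.
Qed.

(** All sizes at least [c] are listed, so one nonzero minor of size [\rank A] settles the converse.
    Repeated indices in [f] or [g] only add zero determinants. *)
Lemma mxrank_lt_minors (K : fieldType) m p (A : 'M[K]_(m, p)) c :
  (\rank A < c)%N <->
  forall k (f : 'I_k -> 'I_m) (g : 'I_k -> 'I_p), (c <= k)%N -> \det (mxsub f g A)
    = 0.
Proof.
split=> [rA k f g ck|minors0].
  apply/eqP/negP => /negP d0.
  have uA : mxsub f g A \in unitmx by rewrite unitmxE unitfE.
  have : (\rank (mxsub f g A) <= \rank A)%N.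
    have -> : mxsub f g A = rowsub f 1%:M *m A *m colsub g 1%:M.
      by rewrite mul_rowsub_mx mul1mx mulmx_colsub mulmx1 mxsubcr.
    by rewrite (leq_trans (mxrankM_maxl _ _)) // mxrankM_maxr.
  by rewrite mxrank_unit // => /(leq_trans ck); rewrite leqNgt rA.
rewrite ltnNge; apply/negP => crA.
pose f := maxrankfun A; pose R := rowsub f A.
pose g := maxrankfun R^T; pose S := rowsub g R^T.
have Rfree : row_free R by apply: maxrowsub_free.
have rR : \rank R^T = \rank A by rewrite mxrank_tr; apply/eqP.
have Sfree : row_free S by apply: maxrowsub_free.
(* The column selection is reindexed by the rank of [A] to make the submatrix square. *)
have : exists h : 'I_(\rank R^T) -> 'I_p, row_free (rowsub h R^T) by exists g.
rewrite rR => -[h hS].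
have : \det (mxsub f h A) = 0 by apply: minors0.
have -> : mxsub f h A = (rowsub h R^T)^T.
  by apply/matrixP => i j; rewrite !mxE.
by rewrite det_tr => /eqP; apply/negP; rewrite -unitfE -unitmxE -row_free_unit.
Qed.

Section Bordered.
Variables (K : fieldType) (V : vectType K) (B : {biscalar V}).
Hypothesis nondeg : forall x, (forall y, B x y = 0) -> x = 0.
Local Notation e := (vbasis {:V}).

(* The last column of the bordered matrix cuts out W^\perp and its last row adds
   W to the image, where W is the span of [s]. *)
Lemma rank_bordered m (s : m.-tuple V) (f : 'End(V)) :
  \rank (block_mx (mxof e e f) (form_mx B *m (coord_rows s)^T) (coord_rows s) 0)
  = (\dim <<s>> + \dim (f @: orth B <<s>> + <<s>>))%N.
Proof.
have eb := vbasisP {:V}.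
rewrite block_mxEh mxrank_row_ker rank_col_mx0 (rank_form_coord nondeg); congr addn.
(* The left kernel of [Q] consists of the pairs (x, c) with x in W^\perp and c arbitrary, which [L]
   sends to f x + \sum_i c_i s_i. *)
set Q := col_mx _ 0; set L := col_mx _ (coord_rows s).
rewrite -mxrank_gen -dim_vsof; congr (\dim _); apply/vspaceP => y.
rewrite -rVof_sub // genmxE.
apply/submxP/memv_addP => [[D yE]|[_ /memv_imgP[x xo ->] [z zs ->]]].
  have : D *m kermx Q *m Q = 0 by rewrite -mulmxA mulmx_ker mulmx0.
  move: yE; rewrite mulmxA; move: (D *m kermx Q) => u; rewrite -[u]hsubmxK.
  rewrite !mul_row_col mulmx0 addr0 => yE /sub_kermxP xo.
  exists (f (vecof e (lsubmx u))).
    by apply: memv_img; rewrite (orth_vsof B) -rVof_sub // vecofK.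
  exists (\sum_i rsubmx u 0 i *: s`_i).
    by apply: memv_suml => i _; rewrite memvZ ?memv_span ?mem_nth ?size_tuple.
  by apply: (can_inj (rVofK eb)); rewrite yE linearD /= -mul_coord_rows mul_mxof.
have [c cE] : exists c, rVof e z = c *m coord_rows s.
  by apply/submxP; rewrite sub_coord_rows.
have /submxP[D DE] : (row_mx (rVof e x) c <= kermx Q)%MS.
  by apply/sub_kermxP; rewrite mul_row_col mulmx0 addr0; apply/sub_kermxP;
    rewrite rVof_sub // -orth_vsof.
exists D; rewrite mulmxA -DE mul_row_col -cE linearD /=; congr (_ + _).
by rewrite mul_mxof rVofK.
Qed.

End Bordered.

(** * Zariski closed sets of pairs of flags *)

Section Zariski.
Variables (K : fieldType) (V : vectType K) (n : nat) (Vg : bool -> {vspace V}).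
Local Notation e := (vbasis {:V}).
Implicit Types Z : set (flag V n * flag V n).

Lemma zariski_closed0 : @zariski_closed K V n Vg set0.
Proof.
exists [set 1] => v w _ _; split=> [//|/(_ 1 erefl)/eqP].
by rewrite meval1 oner_eq0.
Qed.

Lemma zariski_closedU Z1 Z2 : zariski_closed Vg Z1 -> zariski_closed Vg Z2 ->
  zariski_closed Vg (Z1 `|` Z2).
Proof.
move=> [I1 I1P] [I2 I2P]; exists [set p | exists p1 p2, [/\ I1 p1, I2 p2 & p = p1 *
  p2]] => v w fv fw.
split=> [[/(I1P _ _ fv fw) Z|/(I2P _ _ fv fw) Z] _ [p1 [p2 [I1p I2p ->]]]|H].
- by rewrite mevalM Z ?mul0r.
- by rewrite mevalM (Z p2) ?mulr0.
have [?|nZ1] := pselect (Z1 (frame_flag v, frame_flag w)); first by left.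
right; apply/(I2P _ _ fv fw) => p2 I2p; apply/eqP/negP => /negP p20; apply: nZ1.
apply/(I1P _ _ fv fw) => p1 I1p; apply/eqP.
have : (p1 * p2).@[frame_coords v w] = 0 by apply: H; exists p1, p2.
by rewrite mevalM => /eqP; rewrite mulf_eq0 (negbTE p20) orbF.
Qed.

Lemma zariski_closed_bigcup (T : eqType) (s : seq T) (F : T -> set (flag V n * flag
  V n)) :
  (forall x, x \in s -> zariski_closed Vg (F x)) ->
  zariski_closed Vg [set P | exists2 x, x \in s & F x P].
Proof.
elim: s => [|x s IHs] Fs.
  rewrite (_ : [set P | _] = set0); first exact: zariski_closed0.
  by apply/seteqP; split=> [P []|].
rewrite (_ : [set P | _] = F x `|` [set P | exists2 y, y \in s & F y P]).
  apply: zariski_closedU; first by apply: Fs; rewrite mem_head.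
  by apply: IHs => y ys; apply: Fs; rewrite in_cons ys orbT.
apply/seteqP; split=> [P [y]|P [FxP|[y ys FyP]]].
- by rewrite in_cons => /predU1P[->|ys] FyP; [left|right; exists y].
- by exists x; rewrite ?mem_head.
- by exists y; rewrite // in_cons ys orbT.
Qed.

Lemma zariski_closed_bigcap (T : Type) (A : set T) (F : T -> set (flag V n * flag V
  n)) :
  (forall x, A x -> zariski_closed Vg (F x)) ->
  zariski_closed Vg [set P | forall x, A x -> F x P].
Proof.
(* Taking all the polynomials that vanish on [F x] avoids choosing equations. *)
move=> FA; pose vanish x := [set p | forall v w, is_frame Vg false v -> is_frame Vg
  true w ->
  F x (frame_flag v, frame_flag w) -> p.@[@frame_coords K V n v w] = 0].
exists [set p | exists2 x, A x & vanish x p] => v w fv fw.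
split=> [H p [x Ax]|H x Ax]; first by apply=> //; apply: H.
have [J JP] := FA x Ax; apply/(JP _ _ fv fw) => p Jp.
by apply: H; exists x => // v' w' fv' fw' /(JP _ _ fv' fw'); apply.
Qed.

Lemma flag_comp_frame i (v : n.-tuple V) : (i <= n)%N ->
  flag_comp (frame_flag v) i = <<take i v>>%VS.
Proof.
move=> le_in; have lt_in : (i < n.+1)%N by [].
rewrite /flag_comp.
by have := tnth_mktuple (fun i : 'I_n.+1 => <<take i v>>%VS) (Ordinal lt_in);
  rewrite (tnth_nth 0%VS).
Qed.

Definition frame_sel (i j : nat) (a : 'I_(n + n)) : bool :=
  if split a is inl b then (b < i)%N else if split a is inr b then (b < j)%N else
    false.

(* Padding with zeros makes the size of the matrices independent of [i] and [j]. *)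
Definition sel_tuple (i j : nat) (v w : n.-tuple V) : (n + n).-tuple V :=
  [tuple if frame_sel i j a then tnth (cat_tuple v w) a else 0 | a < n + n].

Lemma tnth_cat_lshift (v w : n.-tuple V) (b : 'I_n) : tnth (cat_tuple v w) (lshift
  n b) = tnth v b.
Proof. by rewrite !(tnth_nth 0) nth_cat size_tuple /= ltn_ord. Qed.

Lemma tnth_cat_rshift (v w : n.-tuple V) (b : 'I_n) : tnth (cat_tuple v w) (rshift
  n b) = tnth w b.
Proof. by rewrite !(tnth_nth 0) nth_cat size_tuple /= ltnNge leq_addr /= addKn. Qed.

Lemma span_sel_tuple i j v w :
  <<sel_tuple i j v w>>%VS = (<<take i v>> + <<take j w>>)%VS.
Proof.
have takeP k (u : n.-tuple V) (b : 'I_n) : (b < k)%N -> tnth u b \in <<take k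
  u>>%VS.
  move=> bk; apply/memv_span/(nthP 0); exists b;
    first by rewrite size_take size_tuple; case: ifP.
  by rewrite nth_take // -tnth_nth.
apply/eqP; rewrite eqEsubv subv_add; apply/and3P; split; apply/span_subvP => x.
- case/tnthP=> a ->; rewrite tnth_mktuple /frame_sel; case: split_ordP => b ->.
    case: ifP => bi; rewrite ?mem0v // tnth_cat_lshift.
    exact: (subvP (addvSl _ _) _ (takeP _ _ _ bi)).
  case: ifP => bi; rewrite ?mem0v // tnth_cat_rshift.
  exact: (subvP (addvSr _ _) _ (takeP _ _ _ bi)).
- case/(nthP 0) => k; rewrite size_take size_tuple => ki <-.
  have [kn ki'] : (k < n)%N /\ (k < i)%N by case: (ltnP i n) ki; lia.
  rewrite nth_take //; apply/memv_span/tnthP; exists (lshift n (Ordinal kn)).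
  rewrite tnth_mktuple /frame_sel (unsplitK (inl _)) /= ki' tnth_cat_lshift.
  by rewrite (tnth_nth 0).
- case/(nthP 0) => k; rewrite size_take size_tuple => ki <-.
  have [kn ki'] : (k < n)%N /\ (k < j)%N by case: (ltnP j n) ki; lia.
  rewrite nth_take //; apply/memv_span/tnthP; exists (rshift n (Ordinal kn)).
  rewrite tnth_mktuple /frame_sel (unsplitK (inr _)) /= ki' tnth_cat_rshift.
  by rewrite (tnth_nth 0).
Qed.

Variable B : {biscalar V}.
Hypothesis nondeg : forall x, (forall y, B x y = 0) -> x = 0.

(** The rank of the bordered matrix of [f] and W = E_i + F_j. *)
Definition flag_rank (f : 'End(V)) (i j : nat) (P : flag V n * flag V n) : nat :=
  let W := (flag_comp P.1 i + flag_comp P.2 j)%VS in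
  (\dim W + \dim (f @: orth B W + W))%N.

Lemma flag_rank_closed f i j c : (i <= n)%N -> (j <= n)%N ->
  zariski_closed Vg [set P | flag_rank f i j P < c]%N.
Proof.
move=> le_in le_jn; pose N := \dim {:V}; pose R := {mpoly K[(n + n) * N]}.
(* The generic frame: selected coordinates are variables, and the other rows are zero. *)
pose Cp : 'M[R]_(n + n, N) :=
  \matrix_(a, b) if frame_sel i j a then 'X_(mxvec_index a b) else 0.
pose toR := map_mx (@mpolyC ((n + n) * N) K).
pose Pp : 'M[R]_(N + (n + n), N + (n + n)) :=
  block_mx (toR _ _ (mxof e e f)) (toR _ _ (form_mx B) *m Cp^T) Cp 0.
exists [set p | exists k (g h : 'I_k -> _), (c <= k)%N /\ p = \det (mxsub g h Pp)].
move=> v w fv fw; rewrite /flag_rank /= !flag_comp_frame // -span_sel_tuple.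
rewrite -(rank_bordered nondeg).
have -> : block_mx (mxof e e f) (form_mx B *m (coord_rows (sel_tuple i j v w))^T)
    (coord_rows (sel_tuple i j v w)) 0 = map_mx (meval (frame_coords v w)) Pp.
  have Ct : map_mx (meval (frame_coords v w)) Cp = coord_rows (sel_tuple i j v w).
    apply/matrixP => a b; rewrite !mxE tnth_mktuple; case: ifP => _.
      by rewrite mevalXU /frame_coords mxvecE !mxE.
    by rewrite meval0 linear0.
  have toRK m p (A : 'M_(m, p)) : map_mx (meval (frame_coords v w)) (toR _ _ A) = A.
    by apply/matrixP => a b; rewrite !mxE mevalC.
  by rewrite map_block_mx map_mxM -map_trmx !toRK Ct map_mx0.
have detE k (g h : 'I_k -> 'I_(N + (n + n))) :
    (\det (mxsub g h Pp)).@[frame_coords v w] = \det (mxsub g h (map_mx (meval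
      (frame_coords v w)) Pp)).
  by rewrite -det_map_mx map_mxsub.
split=> [/mxrank_lt_minors H _ [k [g [h [ck ->]]]]|H]; first by rewrite detE H.
apply/mxrank_lt_minors => k g h ck; rewrite -detE; apply: H.
by exists k, g, h.
Qed.

End Zariski.

(** * The strata of the Springer fiber *)

Section SpringerStrata.
Variables (K : fieldType) (n : nat) (V : vectType K) (Vg : bool -> {vspace V}).
Variables (B : {biscalar V}) (X : 'End(V)).
Hypotheses (hV : osp_space Vg B (2 * n).+1 n).
Hypotheses (hX : osp_odd Vg B X) (nilX : nilpotent X).

Let direct := osp_direct hV.
Let full := osp_full hV.
Let grade := osp_odd_grade hX.

(** The two flags are interleaved into one chain, with steps of E and F alternating and E first. *)
Definition chain_space (P : flag V n * flag V n) (k : nat) : {vspace V} :=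
  (flag_comp P.1 (uphalf k) + flag_comp P.2 k./2)%VS.

Lemma flag_comp_mono e (E : flag V n) i j : isotropic_flag Vg B e E ->
  (i <= j <= n)%N -> (flag_comp E i <= flag_comp E j)%VS.
Proof.
move=> [_ mono] /andP[/subnK <-]; elim: (j - i)%N => [|d IHd] dn;
  first exact: subvv.
apply: subv_trans (IHd _) _; first by rewrite ltnW.
by apply: (mono (d + i).+1).
Qed.

Lemma springer_stratumE Ds P : springer_stratum n Vg B X Ds P <->
  springer_fiber n Vg B X P /\
  forall k, (1 <= k <= 2 * n)%N ->
    induced_diagram Vg B X (chain_space P k) = nth mset0 Ds k.
Proof.
split=> -[fP H]; (split; first exact: fP); [move=> k k12|move=> i i1n].
  have [k2|k2] := boolP (odd k).
    have e1 : (2 * k.+1./2).-1%N = k by lia.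
    have e2 : k.+1./2.-1 = k./2 by lia.
    by have [+ _] := H k.+1./2 ltac:(lia); rewrite e1 e2 /chain_space uphalfE.
  have [_ +] := H k./2 ltac:(lia).
  rewrite (_ : (2 * k./2)%N = k); last lia.
  by rewrite /chain_space (_ : uphalf k = k./2) //; lia.
have := H (2 * i).-1 ltac:(lia); have := H (2 * i)%N ltac:(lia).
rewrite /chain_space (_ : uphalf (2 * i) = i); last lia.
rewrite (_ : (2 * i)./2 = i); last lia.
rewrite (_ : uphalf (2 * i).-1 = i); last lia.
by rewrite (_ : (2 * i).-1./2 = i.-1); last lia.
Qed.

Section OnePair.
Variable P : flag V n * flag V n.
Hypothesis fP : springer_fiber n Vg B X P.
Local Notation W := (chain_space P).

Let isoE : isotropic_flag Vg B false P.1. Proof. by case: fP. Qed.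
Let isoF : isotropic_flag Vg B true P.2. Proof. by case: fP. Qed.

Lemma chain_space0 : W 0 = 0%VS.
Proof.
have [[dE _ _] [dF _ _]] := (isoE.1 0%N (leq0n n), isoF.1 0%N (leq0n n)).
apply/eqP; rewrite /chain_space /= -subv0 subv_add !subv0.
by rewrite -!dimv_eq0 dE dF.
Qed.

Lemma uphalf_le k : (k <= 2 * n)%N -> (uphalf k <= n)%N /\ (k./2 <= n)%N.
Proof. by lia. Qed.

Lemma img_flag1 i : (0 < i <= n)%N -> (X @: flag_comp P.1 i <= flag_comp P.2
  i.-1)%VS.
Proof. by move=> i1n; case: fP => _ _ /(_ _ i1n)[]. Qed.

Lemma img_flag2 i : (i <= n)%N -> (X @: flag_comp P.2 i <= flag_comp P.1 i)%VS.
Proof.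
case: i => [_|i i1n]; last by case: fP => _ _ /(_ i.+1 i1n)[].
have [dF _ _] := isoF.1 0%N (leq0n n).
by have /eqP -> : flag_comp P.2 0 == 0%VS; rewrite -?dimv_eq0 ?dF // limg0 sub0v.
Qed.

Lemma chain_space_cap k : (k <= 2 * n)%N ->
  (W k :&: Vg false = flag_comp P.1 (uphalf k))%VS /\
  (W k :&: Vg true = flag_comp P.2 k./2)%VS.
Proof.
case/uphalf_le => u h; have [_ E0 _] := isoE.1 _ u; have [_ F1 _] := isoF.1 _ h.
split; apply/vspaceP => v; rewrite memv_cap; apply/andP/idP.
- case=> /memv_addP[a aE [b bF ->]] ve.
  suff -> : b = 0 by rewrite addr0.
  apply/eqP; rewrite -memv0 -direct memv_cap (subvP F1) // andbT.
  by rewrite -[b](addKr a) addrC memvB // (subvP E0).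
- by move=> vE; rewrite (subvP (addvSl _ _)) // (subvP E0).
- case=> /memv_addP[a aE [b bF ->]] ve.
  suff -> : a = 0 by rewrite add0r.
  apply/eqP; rewrite -memv0 -direct memv_cap (subvP E0) //=.
  by rewrite -[a](addrK b) memvB // (subvP F1).
- by move=> vF; rewrite (subvP (addvSr _ _)) // (subvP F1).
Qed.

Lemma dim_chain_space k : (k <= 2 * n)%N -> \dim (W k) = k.
Proof.
move=> k2n; have [u h] := uphalf_le k2n.
have [dE E0 _] := isoE.1 _ u; have [dF F1 _] := isoF.1 _ h.
rewrite dimv_disjoint_sum ?dE ?dF; first by lia.
by apply/eqP; rewrite -subv0 -direct capvS.
Qed.

(** Stability holds because the index of E equals that of F or exceeds it by one, which fits X E_i
    \subset F_(i-1) and X F_i \subset E_i. *)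
Lemma chain_space_reducible k : (k <= 2 * n)%N -> reducible Vg B X (W k).
Proof.
move=> k2n; have [u h] := uphalf_le k2n.
have [dE E0 Eo] := isoE.1 _ u; have [dF F1 Fo] := isoF.1 _ h.
split.
- move=> e _ /memv_addP[a aE [b bF ->]]; rewrite linearD /=.
  have ae := subvP E0 _ aE; have be := subvP F1 _ bF.
  case: e.
    rewrite (hproj0 direct full (e := true)) // (hproj_id direct) // add0r.
    exact: (subvP (addvSr _ _)).
  rewrite (hproj0 direct full (e := false) be) (hproj_id direct) // addr0.
  exact: (subvP (addvSl _ _)).
- apply/subvP => _ /memv_addP[a aE [b bF ->]];
    apply/orthP => _ /memv_addP[a' aE' [b' bF' ->]].
  rewrite linearDl !linearDr /=.
  have -> : B a a' = 0 by apply: (elimT (orthP _ _ _) (subvP Eo _ aE)).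
  have -> : B b b' = 0 by apply: (elimT (orthP _ _ _) (subvP Fo _ bF)).
  have -> : B a b' = 0 by apply: (osp_orth_hom hV (subvP E0 _ aE) (subvP F1 _ bF')).
  have -> : B b a' = 0 by apply: (osp_orth_hom hV (subvP F1 _ bF) (subvP E0 _ aE')).
  by rewrite !addr0.
- rewrite limgD subv_add; apply/andP; split.
    case: k k2n u {h dE E0 Eo dF F1 Fo} => [|k] k2n u.
      by have := chain_space0; rewrite /chain_space /= => W0;
        rewrite (subv_trans (limgS _ (addvSl _ (flag_comp P.2 0)))) // W0 limg0
        sub0v.
    apply: subv_trans (img_flag1 (_ : (0 < uphalf k.+1 <= n)%N)) _; first by lia.
    apply: subv_trans (addvSr _ _).
    by apply: (flag_comp_mono isoF); lia.
  apply: subv_trans (img_flag2 h) _; apply: subv_trans (addvSl _ _).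
  by apply: (flag_comp_mono isoE); lia.
Qed.

(** For k = 2i - 2 the new vector is in E_i and X sends it to F_(i-1); for k = 2i - 1 it is in F_i
    and X sends it to E_i. Both targets lie in W_k. *)
Lemma chain_space_step k : (k < 2 * n)%N ->
  exists2 w, w \in Vg (odd k) & [/\ w \notin W k, X w \in W k & W k.+1 = (W k +
    <[w]>)%VS].
Proof.
move=> k2n; have [u h] := uphalf_le k2n; have [u1 h1] := uphalf_le (ltnW k2n).
have [c0 c1] := chain_space_cap (ltnW k2n).
have dW := dim_chain_space (ltnW k2n); have dW1 := dim_chain_space k2n.
have sW : (W k <= W k.+1)%VS.
  by apply: addvS; [apply: (flag_comp_mono isoE)|apply: (flag_comp_mono isoF)];
    rewrite /=; lia.
(* By dimension, any vector of W_(k+1) outside W_k spans the step. *)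
suff [w we [wW wW1 Xw]] : exists2 w, w \in Vg (odd k) & [/\ w \notin W k, w \in W
  k.+1 & X w \in W k].
  exists w => //; split=> //; apply/eqP; rewrite eq_sym eqEdim subv_add sW -memvE
    wW1 /=.
  rewrite dW1 dimv_disjoint_sum ?dW ?dim_vline.
    by case: eqP wW => [->|]; rewrite ?mem0v //= addn1.
  apply/eqP; rewrite -subv0; apply/subvP => x;
    rewrite memv_cap => /andP[xW /vlineP[c xE]].
  have [c0'|c0'] := eqVneq c 0; first by rewrite xE c0' scale0r mem0v.
  by case/negP: wW; rewrite -[w](scalerK c0') -xE memvZ.
case ok: (odd k).
  have [dF F1 _] := isoF.1 _ h; have [dF' _ _] := isoF.1 _ h1.
  have /subvPn[w wF wF'] : ~~ (flag_comp P.2 k.+1./2 <= flag_comp P.2 k./2)%VS.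
    by apply/negP => /dimvS; rewrite dF dF'; lia.
  have we := subvP F1 _ wF; exists w => //; split.
  - by apply: contra wF' => wW; rewrite -c1 memv_cap wW we.
  - exact: (subvP (addvSr _ _)).
  - apply: (subvP (addvSl _ _)).
    rewrite (_ : uphalf k = k.+1./2) //; apply: (subvP (img_flag2 h));
      exact: memv_img.
have [dE E0 _] := isoE.1 _ u; have [dE' _ _] := isoE.1 _ u1.
have /subvPn[w wE wE'] : ~~ (flag_comp P.1 (uphalf k.+1) <= flag_comp P.1 (uphalf
  k))%VS.
  by apply/negP => /dimvS; rewrite dE dE'; lia.
have we := subvP E0 _ wE; exists w => //; split.
- by apply: contra wE' => wW; rewrite -c0 memv_cap wW we.
- exact: (subvP (addvSl _ _)).
- apply: (subvP (addvSr _ _)).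
  rewrite (_ : k./2 = (uphalf k.+1).-1); last by lia.
  by apply: (subvP (img_flag1 (_ : (0 < uphalf k.+1 <= n)%N)));
    [lia|exact: memv_img].
Qed.

Lemma chain_space_boxes k : (k <= 2 * n)%N ->
  boxes false (induced_diagram Vg B X (W k)) = ((2 * n).+1 - 2 * uphalf k)%N /\
  boxes true (induced_diagram Vg B X (W k)) = (2 * (n - k./2))%N.
Proof.
move=> k2n; have rW := chain_space_reducible k2n;
  have [c0 c1] := chain_space_cap k2n.
have [u h] := uphalf_le k2n.
have [dE _ _] := isoE.1 _ u; have [dF _ _] := isoF.1 _ h.
have := boxes_induced hV hX nilX rW false; have := boxes_induced hV hX nilX rW true.
by rewrite c0 c1 dE dF (osp_dim0 hV) (osp_dim1 hV); lia.
Qed.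

Lemma chain_space_parity k : (k <= 2 * n)%N ->
  has_parity (induced_diagram Vg B X (W k)) (odd k).
Proof.
move=> k2n; have [b0 b1] := chain_space_boxes k2n; exists (n - k./2)%N; split=> //.
by rewrite b0; case ok: (odd k); rewrite ?expr0 ?expr1; lia.
Qed.

Lemma admissible_subdiagram_chain k : 2%:R != 0 :> K -> (k < 2 * n)%N ->
  admissible_subdiagram (induced_diagram Vg B X (W k)) (induced_diagram Vg B X (W
    k.+1)).
Proof.
move=> K2 k2n; have rW := chain_space_reducible (ltnW k2n);
  have rW1 := chain_space_reducible k2n.
split; [exact: (admissible_induced hV hX nilX)|exact: (admissible_induced hV hX
  nilX)|..].
- have [-> ->] := chain_space_boxes (ltnW k2n);
    have [-> ->] := chain_space_boxes k2n; lia.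
- by exists (odd k); split; [apply: chain_space_parity;
    apply: ltnW|apply: (@chain_space_parity k.+1)].
have [w we [wW Xw WE]] := chain_space_step k2n.
rewrite WE in rW1 *; exact: (remove_ends_induced hV hX nilX rW rW1 we wW Xw).
Qed.

(** One k is dim W_k in [flag_rank], the other comes from [graded_rank_quot]; the projection
    restricts X^j to V_(e+j). *)
Lemma flag_rank_chain e j k : (k <= 2 * n)%N ->
  flag_rank B (lfun_pow X j \o hproj Vg (e (+) odd j))%VF (uphalf k) k./2 P
  = (graded_rank (quot_grading (orth B (W k)) (W k) Vg) (quot_end (orth B (W k)) (W
    k) X) e j
     + k + k)%N.
Proof.
move=> k2n; have rW := chain_space_reducible k2n.
have := graded_rank_quot hV hX rW e j; rewrite (dim_chain_space k2n) => ->.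
rewrite /flag_rank -/(W k) (dim_chain_space k2n) addnC; congr (\dim (_ + _) + _)%N.
rewrite limg_comp; congr (_ @: _)%VS; apply/vspaceP => v; rewrite memv_cap.
apply/memv_imgP/andP => [[x xU ->]|[vU ve]]; last by exists v;
  rewrite ?(hproj_id direct).
by rewrite hproj_mem (orth_graded hV rW).
Qed.

Lemma graded_rank_chain0 N e j k : lfun_pow X N = 0 -> (k <= 2 * n)%N -> (N <= j)%N
  ->
  graded_rank (quot_grading (orth B (W k)) (W k) Vg) (quot_end (orth B (W k)) (W k)
    X) e j = 0%N.
Proof.
move=> XN0 k2n /subnK jE; have rW := chain_space_reducible k2n.
have := graded_rank_quot hV hX rW e j.
have -> : lfun_pow X j = 0.
  by apply/lfunP => v; rewrite -jE lfun_powD XN0 !zero_lfunE linear0.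
by rewrite lim0g add0v; lia.
Qed.

End OnePair.

End SpringerStrata.

(** * Partition into locally closed strata *)

Section Partition.
Variables (K : fieldType) (n : nat) (V : vectType K) (Vg : bool -> {vspace V}).
Variables (B : {biscalar V}) (X : 'End(V)).
Hypotheses (hV : osp_space Vg B (2 * n).+1 n).
Hypotheses (hX : osp_odd Vg B X) (nilX : nilpotent X).

Lemma slicing_of_flags P : 2%:R != 0 :> K -> springer_fiber n Vg B X P ->
  exists2 Ds, slicings n (diagram_of Vg X) Ds & springer_stratum n Vg B X Ds P.
Proof.
move=> K2 fP; pose Ds := [tuple induced_diagram Vg B X (chain_space P k) | k < (2 *
  n).+1].
have DsE k : (k <= 2 * n)%N -> nth mset0 Ds k = induced_diagram Vg B X (chain_space
  P k).
  rewrite -ltnS => k2n.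
  have := tnth_mktuple (fun k : 'I_(2 * n).+1 => induced_diagram Vg B X
    (chain_space P k)) (Ordinal k2n).
  by rewrite (tnth_nth mset0).
have D0 : induced_diagram Vg B X (chain_space P 0) = diagram_of Vg X.
  by rewrite (chain_space0 fP) (induced_diagram0 hV hX nilX).2.
exists Ds; last by apply/springer_stratumE; split=> // k /andP[_ k2n]; rewrite DsE.
have [b0 b1] := chain_space_boxes hV hX nilX fP (leq0n _).
split.
- exact: (admissible_diagram_of hV hX K2 nilX).
- by rewrite /diagram_size -D0 b0 b1 /= muln0 !subn0.
- by rewrite DsE.
- case=> // k /andP[_ k2n]; rewrite !DsE ?(ltnW k2n) //=.
  exact: (admissible_subdiagram_chain hV hX nilX fP K2).
Qed.

(** The conditions defining a stratum start at k = 1; the case k = 0 comes from the first entry of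
    the slicing, D(X). *)
Lemma stratum_induced Ds P k : slicings n (diagram_of Vg X) Ds ->
  springer_stratum n Vg B X Ds P -> (k <= 2 * n)%N ->
  induced_diagram Vg B X (chain_space P k) = nth mset0 Ds k.
Proof.
move=> [_ _ Ds0 _] /springer_stratumE[fP DsP]; case: k => [_|k k2n];
  last exact: DsP.
by rewrite (chain_space0 fP) Ds0 (induced_diagram0 hV hX nilX).2.
Qed.

Lemma springer_stratum_locally_closed Ds : slicings n (diagram_of Vg X) Ds ->
  locally_closed_in Vg (springer_fiber n Vg B X) (springer_stratum n Vg B X Ds).
Proof.
move=> hDs; have [[P0 SP0]|S0] := pselect (exists P, springer_stratum n Vg B X Ds
  P); last first.
  exists set0, setT; split; first exact: zariski_closed0.
    by rewrite setCT; apply: zariski_closed0.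
  by rewrite set0I setI0; apply/seteqP; split=> // P SP; case: S0; exists P.
have fP0 : springer_fiber n Vg B X P0 by case: SP0.
have [N XN0] := nilX.
(* The rank conditions are read off a point [P0] of the stratum. *)
pose T := ('I_(2 * n).+1 * bool * 'I_N)%type.
pose F (x : T) := @flag_rank K V n B (lfun_pow X x.2 \o hproj Vg (x.1.2 (+) odd
  x.2))%VF
  (uphalf x.1.1) (x.1.1 : nat)./2.
have Fcl (x : T) c : zariski_closed Vg [set P | F x P < c]%N.
  have [u h] := uphalf_le (ltn_ord x.1.1 : (x.1.1 <= 2 * n)%N).
  exact: (flag_rank_closed Vg (osp_nondegenerate hV) _ c u h).
(* [Z] bounds every rank by its value at [P0], and [C] is the finite union of the closed conditions
   that some rank is smaller; on [Z] outside [C] all ranks are equal to those at [P0]. *)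
pose Z := [set P | forall x, [set: T] x -> [set Q | F x Q < (F x P0).+1]%N P].
pose C := [set P | exists2 x, x \in enum {: T} & [set Q | F x Q < F x P0]%N P].
have FE P : springer_fiber n Vg B X P -> (Z P /\ ~ C P) <-> (forall x, F x P = F x
  P0).
  move=> fP; split=> [[ZP nCP] x|FP].
    apply/eqP; rewrite eqn_leq -ltnS (ZP x I) leqNgt; apply/negP => FPx.
    by apply: nCP; exists x; rewrite ?mem_enum.
  by split=> [x _|[x _]] /=; rewrite FP ?ltnn.
exists Z, (~` C); split.
- by apply: zariski_closed_bigcap => x _; apply: Fcl.
- by rewrite setCK; apply: zariski_closed_bigcup => x _; apply: Fcl.
pose gr (P : flag V n * flag V n) k := graded_rank (quot_grading (orth B
  (chain_space P k)) (chain_space P k) Vg)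
  (quot_end (orth B (chain_space P k)) (chain_space P k) X).
have gr0 P k e j : springer_fiber n Vg B X P -> (k <= 2 * n)%N -> (N <= j)%N -> gr
  P k e j = 0%N.
  by move=> fP k2n Nj; apply: (graded_rank_chain0 hV hX fP e XN0).
have grD P k : springer_fiber n Vg B X P -> (k <= 2 * n)%N ->
    rank_diagram (gr P k) (induced_diagram Vg B X (chain_space P k)).
  by move=> fP k2n; apply: (rank_diagram_induced hV hX nilX (chain_space_reducible
    hV fP k2n)).
(* Equal diagrams give equal ranks by [rank_diagram_inj], and conversely by [rank_diagram_uniq]. *)
apply/seteqP; split=> [P SP|P [fP /(FE _ fP) FP]].
  have fP : springer_fiber n Vg B X P by case: SP.
  split=> //; apply/(FE _ fP) => x.
  have x2n : (x.1.1 <= 2 * n)%N by rewrite -ltnS ltn_ord.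
  rewrite /F !(flag_rank_chain hV hX) //; congr (_ + _ + _)%N.
  have D := grD P _ fP x2n; have D0 := grD P0 _ fP0 x2n.
  rewrite (stratum_induced hDs SP x2n) in D;
    rewrite (stratum_induced hDs SP0 x2n) in D0.
  apply: (rank_diagram_inj (N := N) _ _ D D0) => e j Nj; exact: gr0.
apply/springer_stratumE; split=> // k /andP[_ k2n].
rewrite -(stratum_induced hDs SP0 k2n).
apply: rank_diagram_uniq (grD P0 k fP0 k2n).
have [D0 Dr] := grD P k fP k2n; have grE e j : gr P k e j = gr P0 k e j.
  have [jN|Nj] := ltnP j N; last by rewrite !gr0.
  have := FP (Ordinal (k2n : (k < (2 * n).+1)%N), e, Ordinal jN).
  rewrite /F /= !(flag_rank_chain hV hX) // => /eqP.
  by rewrite !eqn_add2r => /eqP.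
by split=> // e j; rewrite -!grE.
Qed.

End Partition.

Theorem theorem1p12 (R : realType) (n : nat) (hn : (1 <= n)%N)
    (V : vectType R[i]) (Vg : bool -> {vspace V}) (B : {biscalar V})
    (hV : osp_space Vg B (2 * n).+1 n)
    (X : 'End(V)) (hX : osp_odd Vg B X) (hnil : nilpotent X) :
  [/\ forall Ds, slicings n (diagram_of Vg X) Ds ->
        locally_closed_in Vg (springer_fiber n Vg B X)
          (springer_stratum n Vg B X Ds),
      springer_fiber n Vg B X =
        \bigcup_(Ds in slicings n (diagram_of Vg X))
          springer_stratum n Vg B X Ds &
      trivIset (slicings n (diagram_of Vg X)) (springer_stratum n Vg B X)].
Proof.
have K2 : 2%:R != 0 :> R[i] by rewrite Num.Theory.pnatr_eq0.
split.
- by move=> Ds; apply: springer_stratum_locally_closed.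
- apply/seteqP; split=> [P fP|P [Ds _ [fP _]] //].
  by have [Ds hDs SP] := slicing_of_flags hV hX hnil K2 fP; exists Ds.
(* The induced diagrams of a common point are the entries of both slicings. *)
- move=> Ds Ds' hDs hDs' [P [SP SP']]; apply: val_inj.
  apply: (@eq_from_nth _ mset0); first by rewrite !size_tuple.
  move=> k; rewrite size_tuple ltnS => k2n.
  by rewrite -(stratum_induced hV hX hnil hDs SP k2n) (stratum_induced hV hX hnil
    hDs' SP' k2n).
Qed.
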